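(* Let $\Omega\subset\mathbb{R}^N$ be a regular, bounded domain. Let $\Phi:\mathbb{R}^N\to\mathbb{R}^N$ be a $C^2$-mapping such that $$|\nabla\Phi(\mathbf{a})|\le M,\qquad (\Phi(\mathbf{a}_1)-\Phi(\mathbf{a}_0))\cdot(\mathbf{a}_1-\mathbf{a}_0)\ge c\,|\mathbf{a}_1-\mathbf{a}_0|^2,$$ for constants $M,c>0$ and every $\mathbf{a},\mathbf{a}_1,\mathbf{a}_0\in\mathbb{R}^N$. Then, for arbitrary $u_0\in H^1(\Omega)$, there is a unique weak solution $u\in u_0+H^1_0(\Omega)$ of the problem $$\operatorname{div}[\Phi(\nabla u)]=0\ \text{ in }\Omega,\qquad u-u_0\in H^1_0(\Omega).$$ Moreover, there is a constant $C>0$ such that $$\|u-v\|^2_{H^1_0(\Omega)}\le C\,\mathcal{E}(v)$$ for every other $v\in u_0+H^1_0(\Omega)$, where $\mathcal{E}(v)=\frac12\int_\Omega|\nabla U|^2\,d\mathbf{x}$ and $U\in H^1_0(\Omega)$ is the unique (weak) solution of $\operatorname{div}[\Phi(\nabla v)+\nabla U]=0$ in $\Omega$.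
   Context: ''Regular'' means that the boundary of $\Omega$ is as smooth as needed. Equations in divergence form are understood weakly, i.e. tested against functions in $H^1_0(\Omega)$: $u$ is a weak solution of $\operatorname{div}[\Phi(\nabla u)]=0$ if $\int_\Omega\Phi(\nabla u)\cdot\nabla w\,d\mathbf{x}=0$ for all $w\in H^1_0(\Omega)$, and $U\in H^1_0(\Omega)$ solves $\operatorname{div}[\Phi(\nabla v)+\nabla U]=0$ if $\int_\Omega(\Phi(\nabla v)+\nabla U)\cdot\nabla w\,d\mathbf{x}=0$ for all $w\in H^1_0(\Omega)$. Equivalently, $\mathcal{E}(v)=\frac12\|\operatorname{div}[\Phi(\nabla v)]\|^2_{H^{-1}(\Omega)}$. *)

(* Defs.v *)
From HB Require Import structures.
From mathcomp Require Import all_boot all_order all_algebra.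
From mathcomp Require Import all_classical all_reals all_analysis.
Import Order.TTheory GRing.Theory Num.Theory.
Import numFieldNormedType.Exports.

Set Implicit Arguments.
Unset Strict Implicit.
Unset Printing Implicit Defensive.

Local Open Scope classical_set_scope.
Local Open Scope ring_scope.

Definition rV_display : measure_display.
Proof. exact: default_measure_display. Qed.

Section measurable_rV.
Context {R : realType} {n : nat}.

Definition rV_coord (i : 'I_n) (x : 'rV[R]_n) : measurableTypeR R := x ord0 i.

Let rV_set0 : g_sigma_preimage rV_coord set0.
Proof. exact: sigma_algebra0. Qed.

Let rV_setC A : g_sigma_preimage rV_coord A -> g_sigma_preimage rV_coord (~` A).
Proof. exact: sigma_algebraC. Qed.

Let rV_bigcup (F : (set 'rV[R]_n)^nat) :
  (forall i, g_sigma_preimage rV_coord (F i)) ->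
  g_sigma_preimage rV_coord (\bigcup_i (F i)).
Proof. exact: sigma_algebra_bigcup. Qed.

(* The sigma-algebra generated by the coordinates, i.e. the Borel one. *)
HB.instance Definition _ := @isMeasurable.Build rV_display 'rV[R]_n
  (g_sigma_preimage rV_coord) rV_set0 rV_setC rV_bigcup.

Lemma measurable_rV_coord i : measurable_fun [set: 'rV[R]_n] (rV_coord i).
Proof.
move=> _ Y mY; rewrite setTI; apply: sub_sigma_algebra => /=.
rewrite -bigcup_seq/=; exists i => /=; first by rewrite mem_index_enum.
by exists Y => //; rewrite setTI.
Qed.

Lemma measurable_fun_rV d (T : measurableType d) (f : T -> 'rV[R]_n) :
  (forall i, measurable_fun [set: T] (rV_coord i \o f)) ->
  measurable_fun [set: T] f.
Proof.
move=> mf _ A mA; rewrite setTI.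
suff : g_sigma_preimage rV_coord `<=` [set B | measurable (f @^-1` B)] by exact.
apply: smallest_sub.
  split => /=.
  - by rewrite preimage_set0.
  - by move=> B mB; rewrite setTD preimage_setC; exact: measurableC.
  - by move=> F mF; rewrite preimage_bigcup; exact: bigcup_measurable.
rewrite -bigcup_seq => B [i _] [C mC <-] /=.
by rewrite setTI -comp_preimage -[X in measurable X]setTI; exact: mf.
Qed.

End measurable_rV.

Section rV_cons.
Context {R : realType} {n : nat}.

Definition rV_cons (p : measurableTypeR R * 'rV[R]_n) : 'rV[R]_n.+1 :=
  row_mx (const_mx p.1 : 'rV[R]_1) p.2.

Definition rV_uncons (x : 'rV[R]_n.+1) : measurableTypeR R * 'rV[R]_n :=
  (x ord0 ord0, rsubmx (x : 'rV[R]_(1 + n))).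

Lemma rV_consK : cancel rV_cons rV_uncons.
Proof.
case=> a v; congr pair => /=; last exact: row_mxKr.
have E : ord0 = lshift n (ord0 : 'I_1) by exact/val_inj.
rewrite [LHS](congr1 (rV_cons (a, v) ord0) E).
by rewrite [LHS]row_mxEl mxE.
Qed.

Lemma measurable_rV_cons : measurable_fun setT rV_cons.
Proof.
apply: measurable_fun_rV => i; case: (split_ordP (i : 'I_(1 + n))) => j ->.
  rewrite (_ : _ \o _ = fst)//.
  by apply/funext => -[a v]; rewrite [LHS]row_mxEl mxE.
rewrite (_ : _ \o _ = rV_coord j \o snd).
  exact: (measurableT_comp (measurable_rV_coord j)).
by apply/funext => -[a v]; exact: row_mxEr.
Qed.

Lemma measurable_rV_uncons : measurable_fun setT rV_uncons.
Proof.
apply/measurable_fun_pairP; split; first exact: (measurable_rV_coord ord0).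
apply: measurable_fun_rV => i.
rewrite (_ : _ \o _ = rV_coord (rshift 1 i)); first exact: measurable_rV_coord.
by apply/funext => x; rewrite /= /rV_coord mxE.
Qed.

Variable mu : {sigma_finite_measure set 'rV[R]_n -> \bar R}.

Definition rV_prod : set 'rV[R]_n.+1 -> \bar R :=
  pushforward (lebesgue_measure \x mu)%E rV_cons.

Let rV_prod0 : (rV_prod set0 = 0)%E.
Proof. by rewrite /rV_prod /pushforward preimage_set0 measure0. Qed.

Let rV_prod_ge0 A : (0 <= rV_prod A)%E.
Proof. exact: (measure_ge0 (lebesgue_measure \x mu)%E). Qed.

Let rV_prod_sigma_additive : semi_sigma_additive rV_prod.
Proof.
move=> F mF tF mUF; rewrite /rV_prod /pushforward preimage_bigcup.
have mp A : measurable A -> measurable (rV_cons @^-1` A).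
  by move=> mA; rewrite -[X in measurable X]setTI; exact: measurable_rV_cons.
apply: (@measure_semi_sigma_additive _ _ _ (lebesgue_measure \x mu)%E).
- by move=> k; exact: mp.
- apply/trivIsetP => i j _ _ ij; rewrite -preimage_setI.
  by move/trivIsetP : tF => /(_ _ _ I I ij) ->; rewrite preimage_set0.
- by rewrite -preimage_bigcup; exact: mp.
Qed.

HB.instance Definition _ := isMeasure.Build _ _ _ rV_prod
  rV_prod0 rV_prod_ge0 rV_prod_sigma_additive.

Let rV_prod_sigma_finite : sigma_finite setT rV_prod.
Proof.
have /sigma_finiteP[F [TF ndF Foo]] := sigma_finiteT (@lebesgue_measure R).
have /sigma_finiteP[G [TG ndG Goo]] := sigma_finiteT mu.
exists (fun k => rV_uncons @^-1` (F k `*` G k)) => [|k].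
  apply/esym; rewrite -subTset => x _.
  have [i _ Fi] : (\bigcup_i F i) (rV_uncons x).1 by rewrite -TF.
  have [j _ Gj] : (\bigcup_j G j) (rV_uncons x).2 by rewrite -TG.
  exists (maxn i j) => //; split.
  - by move: Fi; exact/subsetPset/ndF/leq_maxl.
  - by move: Gj; exact/subsetPset/ndG/leq_maxr.
have [mF Fk] := Foo k; have [mG Gk] := Goo k; split.
  rewrite -[X in measurable X]setTI; apply: measurable_rV_uncons => //.
  exact: measurableX.
rewrite /rV_prod /pushforward -comp_preimage (_ : _ \o _ = id).
  by rewrite /= product_measure1E// lte_mul_pinfty// ge0_fin_numE.
by apply/funext => p; exact: rV_consK.
Qed.

HB.instance Definition _ := Measure_isSigmaFinite.Build _ _ _ rV_prod
  rV_prod_sigma_finite.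

End rV_cons.

Fixpoint rV_lebesgue (R : realType) (n : nat) :
    {sigma_finite_measure set 'rV[R]_n -> \bar R} :=
  match n with
  | 0 => \d_(0 : 'rV[R]_0)
  | n'.+1 => rV_prod (@rV_lebesgue R n')
  end.
Arguments rV_lebesgue {R n}.

Lemma rV_lebesgue_box (R : realType) (n : nat)
    (A : 'I_n -> set (measurableTypeR R)) :
  (forall i, measurable (A i)) ->
  rV_lebesgue [set x : 'rV[R]_n | forall i, A i (x ord0 i)] =
  (\prod_(i < n) lebesgue_measure (A i))%E.
Proof.
elim: n A => [|n IHn] A mA /=.
  by rewrite big_ord0 diracE mem_set// => -[].
rewrite big_ord_recl -IHn; last by move=> i; exact: mA.
rewrite -product_measure1E//; last first.
  rewrite (_ : mkset _ = \bigcap_(i in [set: 'I_n])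
      (rV_coord i @^-1` A (lift ord0 i))).
    apply: fin_bigcap_measurable => // i _.
    by rewrite -[X in measurable X]setTI; exact: measurable_rV_coord.
  by apply/seteqP; split=> x xA i; [move=> _|]; exact: xA.
rewrite /rV_prod /pushforward; congr (product_measure1 _ _ _).
have E0 p : @rV_cons R n p ord0 ord0 = p.1.
  by have /(congr1 fst) := rV_consK p.
have E1 p i : @rV_cons R n p ord0 (lift ord0 i) = p.2 ord0 i.
  have E : lift ord0 i = rshift 1 i by exact/val_inj.
  rewrite [LHS](congr1 (rV_cons p ord0) E); exact: row_mxEr.
apply/seteqP; split=> [p /= pA|p /= [pA0 pA1] i].
  split; first by have := pA ord0; rewrite E0.
  by move=> i; have := pA (lift ord0 i); rewrite E1.
by case: (unliftP ord0 i) => [j|] ->; rewrite ?E0 ?E1.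
Qed.

Section calculus.
Context {R : realType} {n : nat}.
Implicit Types (f phi : 'rV[R]_n -> R) (Phi : 'rV[R]_n -> 'rV[R]_n).

Definition dotp (a b : 'rV[R]_n) : R := \sum_i a ord0 i * b ord0 i.

(* Euclidean norm of a vector, Frobenius norm of a matrix; the library norm
   on matrices is the sup norm. *)
Definition enorm p q (A : 'M[R]_(p, q)) : R :=
  Num.sqrt (\sum_i \sum_j A i j ^+ 2).

Definition partial (i : 'I_n) f : 'rV[R]_n -> R := 'D_(delta_mx ord0 i) f.

Fixpoint classC (k : nat) f : Prop :=
  continuous f /\
  match k with
  | 0 => True
  | k'.+1 => forall i, (forall x, derivable f x (delta_mx ord0 i)) /\
                       classC k' (partial i f)
  end.

Definition grad f (x : 'rV[R]_n) : 'rV[R]_n := \row_i partial i f x.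

Definition jacmx Phi (a : 'rV[R]_n) : 'M[R]_n :=
  \matrix_(i, j) partial j (fun b => Phi b ord0 i) a.

Definition test_function (Omega : set 'rV[R]_n) phi : Prop :=
  (forall k, classC k phi) /\
  exists K : set 'rV[R]_n,
    [/\ compact K, K `<=` Omega & forall x, ~ K x -> phi x = 0].

(* Near each boundary point Omega is the strict epigraph, in the unit
   direction e, of a C^1 function gamma of the coordinates orthogonal to e. *)
Definition C1_boundary (Omega : set 'rV[R]_n) : Prop :=
  forall x, (closure Omega `\` Omega^°) x ->
  exists (r : R) (e : 'rV[R]_n) (gamma : 'rV[R]_n -> R),
    [/\ 0 < r, enorm e = 1, classC 1 gamma,
        forall y t, gamma (y + t *: e) = gamma y &
        forall y, enorm (y - x) < r -> (Omega y <-> gamma y < dotp y e)].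

End calculus.

(* An element of H^1 is a function bundled with its weak gradient; elements
   are identified when they agree almost everywhere (see [sob_eq]). *)
Notation sob R n :=
  (('rV[R]_n -> R) * ('rV[R]_n -> 'rV[R]_n))%type (only parsing).

Section sobolev.
Context {R : realType} {n : nat} (Omega : set 'rV[R]_n).
Implicit Types (u v w U : sob R n) (Phi : 'rV[R]_n -> 'rV[R]_n).
Local Notation leb := (@rV_lebesgue R n).

Definition L2 (f : 'rV[R]_n -> R) : Prop :=
  measurable_fun Omega f /\ leb.-integrable Omega (fun x => (f x ^+ 2)%:E).

Definition H1 : set (sob R n) := [set u : sob R n |
  [/\ L2 u.1,
      forall i, L2 (fun x => u.2 x ord0 i) &
      forall phi i, test_function Omega phi ->
        \int[leb]_(x in Omega) (u.1 x * partial i phi x) =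
        - \int[leb]_(x in Omega) (u.2 x ord0 i * phi x)]].

Definition H1_normsq w : R :=
  \int[leb]_(x in Omega) (w.1 x ^+ 2) +
  \int[leb]_(x in Omega) (enorm (w.2 x) ^+ 2).

(* The closure in H^1 of the test functions. *)
Definition H10 : set (sob R n) := [set w : sob R n | H1 w /\
  forall eps : R, 0 < eps ->
    exists2 phi, test_function Omega phi & H1_normsq (w - (phi, grad phi)) < eps].

Definition sob_eq u v : Prop :=
  {ae leb, forall x, Omega x -> u.1 x = v.1 x /\ u.2 x = v.2 x}.

Definition weak_solution Phi u : Prop :=
  forall w, H10 w -> \int[leb]_(x in Omega) dotp (Phi (u.2 x)) (w.2 x) = 0.

Definition corrector Phi v : set (sob R n) := [set U : sob R n | H10 U /\
  forall w, H10 w ->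
    \int[leb]_(x in Omega) dotp (Phi (v.2 x) + U.2 x) (w.2 x) = 0].

Definition error_functional Phi v : R :=
  2^-1 * \int[leb]_(x in Omega) (enorm ((get (corrector Phi v)).2 x) ^+ 2).

End sobolev.

(* Main.v *)
Require Import Defs.
From mathcomp Require Import all_boot all_order all_algebra.
From mathcomp Require Import all_classical all_reals all_analysis.
From mathcomp Require Import measurable_realfun.
From mathcomp Require Import ring lra.
Import Order.TTheory GRing.Theory Num.Theory.
Import numFieldNormedType.Exports.
Local Open Scope classical_set_scope.
Local Open Scope ring_scope.

(** On [H10 Omega] the form [(u, v) |-> \int grad u . grad v] is a complete
    semi-inner product, so Riesz representation sends every [v] in the affine
    space [u0 + H10] to its corrector [U(v)], the element of [H10] with
    [\int grad U(v) . grad w = - \int Phi (grad v) . grad w] for all [w] in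
    [H10].  Solving the equation means finding a zero of [U], and
    [error_functional] is half the square of the norm of [U(v)].

    Everything rests on two properties of [U] inherited from [Phi].  Strong
    monotonicity of [Phi] and the Cauchy-Schwarz inequality give
    [c |v1 - v2| <= |U(v1) - U(v2)|] ([strongly_monotone_residual]).  Since
    [U(u) = 0] at a solution [u], this yields at once the uniqueness of [u] and
    the estimate [|u - v|^2 <= (2 / c^2) error_functional v]; Poincare's
    inequality then passes from the gradient norm to the [H1] norm.  The bound
    on the Jacobian makes [Phi] Lipschitz, hence [U] Lipschitz, with a constant
    [L] for the squares.  So the step [v |-> v + (c / L) U(v)] multiplies
    [|U(v)|^2] by at most [1 - c^2 / L]: the error functional decreases
    geometrically along the iterates, which by the first inequality form a
    Cauchy sequence, and their limit is a zero of [U] ([zarantonello]).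

    The analysis behind this is the completeness of [H10] for the gradient norm
    ([H10_grad_complete]).  It combines the completeness of [L^2]
    ([riesz_fischer]), the stability of the defining identity of weak gradients
    under [L^2] limits, and [poincare].  The latter needs no integration along
    lines: testing the weak gradient [g] of [w] against [x_i phi_k], where the
    test functions [phi_k] converge to [w], and letting [k] tend to infinity
    gives [\int w^2 = - 2 \int x_i w g_i], and [x_i] is bounded on [Omega]. *)

(** * Semi-inner products, Riesz representation and strongly monotone operators *)

Lemma squeeze_cvg0 {R : realType} (f g : nat -> R) :
  (forall k, 0 <= f k <= g k) -> g k @[k --> \oo] --> (0 : R) ->
  f k @[k --> \oo] --> (0 : R).
Proof.
by move=> fg g0; apply: (@squeeze_cvgr _ _ _ _ (cst 0) g) => //;
  [exact: nearW|exact: cvg_cst].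
Qed.

Lemma cvg0Ml {R : realType} (a : R) (f : nat -> R) :
  f k @[k --> \oo] --> (0 : R) -> a * f k @[k --> \oo] --> (0 : R).
Proof. by move=> f0; rewrite -[X in _ --> X](mulr0 a); exact: cvgMl_tmp. Qed.

Lemma cvg0D {R : realType} (f g : nat -> R) :
  f k @[k --> \oo] --> (0 : R) -> g k @[k --> \oo] --> (0 : R) ->
  f k + g k @[k --> \oo] --> (0 : R).
Proof. by move=> f0 g0; rewrite -[X in _ --> X](addr0 0); exact: cvgD. Qed.

Section SemiInner.
Context {R : realType} {V : lmodType R}.
Implicit Types (H : set V) (b : V -> V -> R) (u v w : V).

Definition subspace H := H 0 /\ forall a u v, H u -> H v -> H (a *: u + v).

(** Integrals are linear only on integrable functions, hence the restriction of
    linearity to a subspace [H]; symmetry and positivity of [\int f g] hold for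
    all functions.  The form is only semi-definite because functions that are
    equal almost everywhere are not identified. *)
Record semi_inner H b : Prop := SemiInner {
  si_sub : subspace H ;
  si_sym : forall u v, b u v = b v u ;
  si_lin : forall a u v w, H u -> H v -> H w ->
             b (a *: u + v) w = a * b u w + b v w ;
  si_ge0 : forall u, 0 <= b u u }.

(** Completeness, for sequences that are Cauchy with a known rate [e]; both
    sequences built below come with one. *)
Definition rate_complete H b :=
  forall (u : nat -> V) (e : nat -> R), (forall k, H (u k)) ->
    e @ \oo --> (0 : R) ->
    (forall j k, (k <= j)%N -> b (u j - u k) (u j - u k) <= e k) ->
    exists2 l, H l & b (u k - l) (u k - l) @[k --> \oo] --> (0 : R).

Section subspace.
Context {H} (sH : subspace H).

Lemma subspaceZ a u : H u -> H (a *: u).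
Proof. by move=> Hu; rewrite -[_ *: _]addr0; apply: sH.2 => //; exact: sH.1. Qed.

Lemma subspaceD u v : H u -> H v -> H (u + v).
Proof. by move=> Hu Hv; rewrite -[u]scale1r; exact: sH.2. Qed.

Lemma subspaceB u v : H u -> H v -> H (u - v).
Proof.
by move=> Hu Hv; apply: subspaceD => //; rewrite -scaleN1r; exact: subspaceZ.
Qed.

End subspace.

Section form.
Context {H b} (sb : semi_inner H b).
Let sH := si_sub _ _ sb.
Local Notation q u := (b u u).

Lemma formDl u v w : H u -> H v -> H w -> b (u + v) w = b u w + b v w.
Proof. by move=> *; rewrite -[u]scale1r (si_lin _ _ sb)// scale1r mul1r. Qed.

Lemma form0l w : H w -> b 0 w = 0.
Proof.
move=> Hw; have := si_lin _ _ sb 1 0 0 w sH.1 sH.1 Hw.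
by rewrite scaler0 addr0; lra.
Qed.

Lemma formZl a u w : H u -> H w -> b (a *: u) w = a * b u w.
Proof.
move=> Hu Hw; rewrite -[_ *: _]addr0 (si_lin _ _ sb)//; last exact: sH.1.
by rewrite form0l// addr0.
Qed.

Lemma formBl u v w : H u -> H v -> H w -> b (u - v) w = b u w - b v w.
Proof.
move=> Hu Hv Hw; rewrite -scaleN1r formDl ?formZl//; first by rewrite mulN1r.
exact: subspaceZ.
Qed.

Lemma quadD a u v : H u -> H v ->
  q (u + a *: v) = q u + 2 * a * b u v + a ^+ 2 * q v.
Proof.
move=> Hu Hv; have Hav := subspaceZ sH a v Hv.
have Huv := subspaceD sH _ _ Hu Hav.
rewrite formDl// formZl// ![b _ (u + _)](si_sym _ _ sb) !formDl//.
by rewrite !formZl// (si_sym _ _ sb v u); ring.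
Qed.

Lemma quadB u v : H u -> H v -> q (u - v) = q u - 2 * b u v + q v.
Proof. by move=> Hu Hv; rewrite -scaleN1r quadD//; ring. Qed.

Lemma quadC u v : H u -> H v -> q (u - v) = q (v - u).
Proof. by move=> Hu Hv; rewrite !quadB// (si_sym _ _ sb v u); ring. Qed.

Lemma quad_leD u v : H u -> H v -> q (u + v) <= 2 * (q u + q v).
Proof.
move=> Hu Hv; have := si_ge0 _ _ sb (u - v); rewrite quadB//.
by rewrite -[v in q (u + v)]scale1r quadD//; lra.
Qed.

Lemma quad_leB u v : H u -> H v -> q (u - v) <= 2 * (q u + q v).
Proof.
move=> Hu Hv; have := si_ge0 _ _ sb (u + v).
by rewrite -[v in q (u + v)]scale1r quadD// quadB//; lra.
Qed.

Lemma cauchy_schwarz u v : H u -> H v -> b u v ^+ 2 <= q u * q v.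
Proof.
move=> Hu Hv; have q0 a : 0 <= q u + 2 * a * b u v + a ^+ 2 * q v.
  by rewrite -quadD//; exact: si_ge0 sb _.
have := si_ge0 _ _ sb v; rewrite le_eqVlt => /predU1P[qv0|qv].
  rewrite -qv0 mulr0; have [->|bn0] := eqVneq (b u v) 0; first by rewrite expr0n.
  have := q0 (- (q u + 1) / (2 * b u v)); rewrite -qv0 mulr0 addr0.
  have -> : 2 * (- (q u + 1) / (2 * b u v)) * b u v = - (q u + 1) by field.
  by lra.
have := q0 (- b u v / q v); rewrite -(ler_pM2r qv) mul0r.
have -> : (q u + 2 * (- b u v / q v) * b u v + (- b u v / q v) ^+ 2 * q v) * q v
  = q u * q v - b u v ^+ 2 by field; rewrite gt_eqF.
by lra.
Qed.

(** By the Cauchy-Schwarz inequality; this is how limits are taken below in the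
    weak gradient identities. *)
Lemma form_cvg (f : nat -> V) u w : (forall k, H (f k)) -> H u -> H w ->
  q (f k - u) @[k --> \oo] --> (0 : R) -> b (f k) w @[k --> \oo] --> b u w.
Proof.
move=> Hf Hu Hw fu.
have sq : (b (f k) w - b u w) ^+ 2 @[k --> \oo] --> (0 : R).
  apply: (@squeeze_cvg0 _ _ (fun k => q (f k - u) * q w)) => [k|].
    by rewrite sqr_ge0/= -formBl//; apply: cauchy_schwarz => //; exact: subspaceB.
  by rewrite -[X in _ --> X](mul0r (q w)); apply: cvgMr_tmp.
apply/cvgrPdist_le => eps e0; have e20 : 0 < eps ^+ 2 by rewrite exprn_gt0.
move/cvgrPdist_le : sq => /(_ _ e20); apply: filterS => k.
rewrite sub0r normrN normrX ler_sqr ?nnegrE ?normr_ge0 ?(ltW e0)//.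
by rewrite distrC.
Qed.

End form.

(** The representative minimises [J w = |w|^2 - 2 l w].  By the parallelogram
    identity a minimising sequence is Cauchy, and minimality along each line
    through its limit is the asserted equation. *)
Lemma riesz {H b} (sb : semi_inner H b) (l : V -> R) K :
  rate_complete H b -> 0 <= K ->
  (forall a u v, H u -> H v -> l (a *: u + v) = a * l u + l v) ->
  (forall w, H w -> l w ^+ 2 <= K * b w w) ->
  exists2 U, H U & forall w, H w -> b U w = l w.
Proof.
move=> cb K0 ll lK; have sH := si_sub _ _ sb.
have lD u v a : H u -> H v -> l (u + a *: v) = l u + a * l v.
  by move=> Hu Hv; rewrite addrC ll// addrC.
pose J w := b w w - 2 * l w.
have J_ge w : H w -> - K <= J w.
  move=> Hw; have := lK _ Hw; have q0 := si_ge0 _ _ sb w; rewrite /J => lw.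
  suff : 2 * l w <= K + b w w by lra.
  rewrite leNgt; apply/negP => ltl.
  have : (K + b w w) ^+ 2 < (2 * l w) ^+ 2.
    by rewrite ltr_sqr ?nnegrE//; lra.
  by have := sqr_ge0 (K - b w w); nra.
have Jinf : has_inf [set J w | w in H].
  split; first by exists (J 0), 0 => //; exact: sH.1.
  by exists (- K) => _ [w Hw <-]; exact: J_ge.
set d := inf [set J w | w in H].
have Jd w : H w -> d <= J w.
  by move=> Hw; apply: ge_inf; [exact: Jinf.2|exists w].
have /choice[f Hf] k : exists w, H w /\ J w < d + k.+1%:R^-1.
  have k0 : 0 < (k.+1%:R^-1 : R) by rewrite invr_gt0.
  by have [_ [w Hw <-] Jw] := inf_adherent k0 Jinf; exists w.
have inv0 : (k.+1%:R^-1 : R) @[k --> \oo] --> (0 : R) by exact: cvg_harmonic.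
have [||j k kj|U HU fU] := cb f (fun k => 4 * k.+1%:R^-1).
- by move=> k; exact: (Hf k).1.
- exact: (cvg0Ml _ _ inv0).
- have [[Hj Jj] [Hk Jk]] := (Hf j, Hf k).
  have := Jd _ (subspaceZ sH 2^-1 _ (subspaceD sH _ _ Hj Hk)).
  have jk : (j.+1%:R^-1 : R) <= k.+1%:R^-1.
    by rewrite lef_pV2 ?posrE// ler_nat ltnS.
  have H0 := sH.1; have Hs := subspaceD sH _ _ Hj Hk.
  have l0 : l 0 = 0 by have := ll 1 0 0 H0 H0; rewrite scaler0 addr0; lra.
  have qs := quadD sb 1 _ _ Hj Hk; have ls := lD _ _ 1 Hj Hk.
  rewrite scale1r in qs ls.
  rewrite -[2^-1 *: _]add0r /J (quadD sb)// lD// qs ls l0 !(form0l sb)//.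
  move: jk Jj Jk; rewrite /J (quadB sb)//.
  by set ij := j.+1%:R^-1; set ik := k.+1%:R^-1; lra.
exists U => // w Hw; set q := b w w; set beta := b U w - l w.
have q0 : 0 <= q := si_ge0 _ _ sb w.
(* The choice of [t] that makes the quadratic negative unless [beta = 0];
   adding 1 to [q] covers the case of a null vector [w]. *)
suff E t : 0 <= 2 * t * beta + t ^+ 2 * q.
  have := E (- beta / (q + 1)).
  have -> : 2 * (- beta / (q + 1)) * beta + (- beta / (q + 1)) ^+ 2 * q =
      - (beta ^+ 2 * ((q + 2) / (q + 1) ^+ 2)) by field; lra.
  rewrite oppr_ge0 pmulr_lle0; last by rewrite divr_gt0 ?exprn_gt0//; lra.
  move=> b0; have /eqP : beta ^+ 2 == 0 by rewrite eq_le b0 sqr_ge0.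
  by move/eqP; rewrite sqrf_eq0 subr_eq0 => /eqP.
have /cvgr_to_ge : 2 * t * (b (f k) w - l w) + t ^+ 2 * q + k.+1%:R^-1
    @[k --> \oo] --> 2 * t * beta + t ^+ 2 * q + 0.
  apply: cvgD => //; apply: cvgD; last exact: cvg_cst.
  apply: cvgMl_tmp; apply: cvgB; last exact: cvg_cst.
  by apply: (form_cvg sb) => // k; exact: (Hf k).1.
rewrite addr0; apply; apply: nearW => k.
have [Hk Jk] := Hf k; have := Jd _ (subspaceD sH _ _ Hk (subspaceZ sH t _ Hw)).
by move: Jk; rewrite /J (quadD sb)// lD// -/q; set ik := k.+1%:R^-1; lra.
Qed.

(** The distance between two points is controlled by the distance between the
    representatives [U1], [U2] of their residuals: test the difference of the
    two residuals against [v1 - v2] and apply the Cauchy-Schwarz inequality. *)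
Lemma strongly_monotone_residual {H b} (sb : semi_inner H b) (A : V -> V -> R)
    c v1 v2 U1 U2 : 0 < c -> H v1 -> H v2 -> H U1 -> H U2 ->
  c * b (v1 - v2) (v1 - v2) <= A v1 (v1 - v2) - A v2 (v1 - v2) ->
  (forall w, H w -> b U1 w = - A v1 w) ->
  (forall w, H w -> b U2 w = - A v2 w) ->
  c ^+ 2 * b (v1 - v2) (v1 - v2) <= b (U1 - U2) (U1 - U2).
Proof.
move=> c0 Hv1 Hv2 HU1 HU2 mono U1E U2E; have sH := si_sub _ _ sb.
have Hd := subspaceB sH _ _ Hv1 Hv2; have HU := subspaceB sH _ _ HU1 HU2.
have := cauchy_schwarz sb (U1 - U2) (v1 - v2) HU Hd.
rewrite (formBl sb)// U1E// U2E//.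
have := si_ge0 _ _ sb (v1 - v2); have := si_ge0 _ _ sb (U1 - U2).
move: mono; set q := b _ _; set Q := b _ _; set a := A _ _; set a' := A _ _.
move=> mono Q0; rewrite le_eqVlt => /predU1P[<-|q0]; first by move=> _; rewrite mulr0.
move=> cs; rewrite -(ler_pM2r q0); apply: le_trans cs.
rewrite -mulrA -expr2 -exprMn -(sqrrN (- a - _)).
have cq0 : 0 <= c * q by rewrite mulr_ge0// ltW.
have -> : - (- a - - a') = a - a' by ring.
by rewrite ler_sqr// nnegrE; lra.
Qed.

(** With [S v] the representative of [- A v], the step [v |-> v + rho S v] for
    [rho = c / L] contracts [|S v|^2] by [kappa = 1 - c^2 / L]: strong
    monotonicity bounds [<S v, S v' - S v>] by [- c rho |S v|^2], and the
    Lipschitz property bounds [|S v' - S v|^2] by [L rho^2 |S v|^2].  The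
    residuals of the iterates thus tend to 0 geometrically, and
    [strongly_monotone_residual] turns this into a Cauchy rate for the iterates
    themselves. *)
Lemma zarantonello {H b} (sb : semi_inner H b) (A : V -> V -> R) c L :
  rate_complete H b -> 0 < c -> 0 < L ->
  (forall v, H v -> forall a w1 w2, H w1 -> H w2 ->
     A v (a *: w1 + w2) = a * A v w1 + A v w2) ->
  (forall v, H v -> exists2 K, 0 <= K &
     forall w, H w -> A v w ^+ 2 <= K * b w w) ->
  (forall v1 v2 w, H v1 -> H v2 -> H w ->
     (A v1 w - A v2 w) ^+ 2 <= L * b (v1 - v2) (v1 - v2) * b w w) ->
  (forall v1 v2, H v1 -> H v2 ->
     c * b (v1 - v2) (v1 - v2) <= A v1 (v1 - v2) - A v2 (v1 - v2)) ->
  exists2 u, H u & forall w, H w -> A u w = 0.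
Proof.
(* Enlarging [L] to [L + c^2] makes the factor [1 - c^2 / L] nonnegative. *)
move=> cb c0; wlog cL : L / c ^+ 2 <= L.
  move=> W L0 Al AK AL Am; apply: (W (L + c ^+ 2)) => //.
  - by rewrite lerDr ltW.
  - by rewrite addr_gt0// exprn_gt0.
  - move=> v1 v2 w Hv1 Hv2 Hw; apply: le_trans (AL _ _ _ Hv1 Hv2 Hw) _.
    apply: ler_wpM2r; first exact: si_ge0 sb _.
    by apply: ler_wpM2r; [exact: si_ge0 sb _|rewrite lerDl sqr_ge0].
move=> L0 Al AK AL Am; have sH := si_sub _ _ sb.
have /choice[S SE] v : exists U, H v -> H U /\ forall w, H w -> b U w = - A v w.
  have [Hv|nHv] := pselect (H v); last by exists 0.
  have [K K0 vK] := AK _ Hv.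
  have [|w Hw|U HU UE] := riesz sb (fun w => - A v w) K cb K0.
  - by move=> a w1 w2 Hw1 Hw2; rewrite Al//; ring.
  - by rewrite sqrrN; exact: vK.
  - by exists U.
have HS v : H v -> H (S v) by case/SE.
pose rho := c / L; pose kappa := 1 - c ^+ 2 / L.
have rho0 : 0 < rho by rewrite divr_gt0.
have descent v : H v ->
    b (S (v + rho *: S v)) (S (v + rho *: S v)) <= kappa * b (S v) (S v).
  move=> Hv; set v' := v + _; have HSv := HS _ Hv.
  have Hv' : H v' by apply: subspaceD => //; exact: subspaceZ.
  have HSv' := HS _ Hv'; have HD := subspaceB sH _ _ HSv' HSv.
  have dv : v' - v = 0 + rho *: S v by rewrite /v' add0r addrAC subrr add0r.
  have qdv : b (v' - v) (v' - v) = rho ^+ 2 * b (S v) (S v).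
    rewrite dv (quadD sb)//; last exact: sH.1.
    by rewrite !(form0l sb)//; [ring|exact: sH.1].
  have Adv u : H u -> A u (v' - v) = rho * A u (S v).
    move=> Hu; rewrite dv addrC Al//; last exact: sH.1.
    have : A u (1 *: 0 + 0) = A u 0 + A u 0.
      by rewrite Al ?mul1r//; exact: sH.1.
    by rewrite scaler0 addr0; lra.
  have := Am _ _ Hv' Hv; rewrite qdv !Adv// => mono.
  have -> : S v' = S v + 1 *: (S v' - S v) by rewrite scale1r addrC subrK.
  have bSD : b (S v) (S v' - S v) = A v (S v) - A v' (S v).
    rewrite (si_sym _ _ sb) (formBl sb)// (SE _ Hv').2// (SE _ Hv).2//.
    by rewrite addrC opprK.
  rewrite (quadD sb)// bSD.
  have QD : b (S v' - S v) (S v' - S v) <= L * rho ^+ 2 * b (S v) (S v).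
    have := AL v' v (S v' - S v) Hv' Hv HD; rewrite qdv mulrA.
    rewrite -(sqrrN (_ - _)).
    have <- : b (S v' - S v) (S v' - S v) = - (A v' (S v' - S v) - A v (S v' - S v)).
      by rewrite (formBl sb) ?(SE _ Hv').2 ?(SE _ Hv).2//; ring.
    set x := b (_ - _) _; set y := L * _ * _ => x2.
    have y0 : 0 <= y.
      apply: mulr_ge0; last exact: si_ge0 sb _.
      by apply: mulr_ge0; [exact: ltW|exact: sqr_ge0].
    rewrite leNgt; apply/negP => yx; have x0 := le_lt_trans y0 yx.
    by move: x2; rewrite expr2 ler_pM2r// leNgt yx.
  have cr : c = L * rho by rewrite /rho mulrC divfK// gt_eqF.
  have -> : kappa = 1 - c * rho by rewrite /kappa /rho expr2 mulrA.
  move: QD; rewrite [rho ^+ 2]expr2 mulrA -cr.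
  have : c * rho * b (S v) (S v) <= A v' (S v) - A v (S v).
    by rewrite -(ler_pM2l rho0); move: mono; rewrite -/v'; nra.
  by lra.
pose f k := iter k (fun v => v + rho *: S v) 0.
have Hf k : H (f k).
  elim: k => [|k IHk]; first exact: sH.1.
  by apply: subspaceD => //; apply: subspaceZ => //; exact: HS.
pose q0 := b (S 0) (S 0).
have k01 : 0 <= kappa < 1.
  by rewrite subr_ge0 ler_pdivrMr// mul1r cL ltrBlDr ltrDl divr_gt0 ?exprn_gt0.
have qf k : b (S (f k)) (S (f k)) <= kappa ^+ k * q0.
  elim: k => [|k IHk]; first by rewrite expr0 mul1r.
  apply: le_trans (descent _ (Hf k)) _; rewrite exprS -mulrA.
  by apply: ler_wpM2l IHk; case/andP: k01.
have geo : kappa ^+ k * q0 @[k --> \oo] --> (0 : R).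
  rewrite -[X in _ --> X](mul0r q0); apply: cvgMr_tmp; apply: cvg_expr.
  by case/andP: k01 => k0 k1; rewrite ger0_norm.
have geo' (a : R) : a * (kappa ^+ k * q0) @[k --> \oo] --> (0 : R).
  exact: (cvg0Ml _ _ geo).
have [|j k kj|u Hu fu] := cb f (fun k => 4 / c ^+ 2 * (kappa ^+ k * q0)) Hf.
- exact: geo'.
- have := strongly_monotone_residual sb A c _ _ _ _ c0 (Hf j) (Hf k)
    (HS _ (Hf j)) (HS _ (Hf k)) (Am _ _ (Hf j) (Hf k))
    (SE _ (Hf j)).2 (SE _ (Hf k)).2.
  have := quad_leB sb _ _ (HS _ (Hf j)) (HS _ (Hf k)).
  have kjq : kappa ^+ j * q0 <= kappa ^+ k * q0.
    apply: ler_wpM2r; first exact: si_ge0 sb _.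
    by case/andP: k01 => k0 k1; apply: ler_wiXn2l => //; exact: ltW.
  have := qf j; have := qf k => h1 h2 h3 h4.
  rewrite -(@ler_pM2l _ (c ^+ 2)) ?exprn_gt0// !mulrA.
  by rewrite [c ^+ 2 * 4]mulrC mulfK ?expf_neq0 ?gt_eqF// -mulrA; lra.
exists u => // w Hw.
have lim0 : 2 * L * b w w * b (f k - u) (f k - u) +
    2 * b w w * (kappa ^+ k * q0) @[k --> \oo] --> (0 : R).
  exact: (cvg0D _ _ (cvg0Ml _ _ fu) (geo' _)).
have : A u w ^+ 2 <= 0.
  apply: (@cvgr_to_ge _ _ _ _ _ _ _ lim0); apply: nearW => k.
  have := AL _ _ _ (Hf k) Hu Hw.
  have := cauchy_schwarz sb _ _ (HS _ (Hf k)) Hw; rewrite (SE _ (Hf k)).2//.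
  have : b (S (f k)) (S (f k)) * b w w <= kappa ^+ k * q0 * b w w.
    by apply: ler_wpM2r; [exact: si_ge0 sb _|exact: qf].
  set x := A (f k) w; set y := A u w.
  have := sqr_ge0 (2 * x - y).
  by nra.
rewrite le_eqVlt ltNge sqr_ge0 orbF sqrf_eq0 => /eqP//.
Qed.

End SemiInner.

(** * Square-integrable functions on a measured domain *)

Section SquareIntegrable.
Context {d} {T : measurableType d} {R : realType}.
Variables (mu : {measure set T -> \bar R}) (D : set T).
Hypothesis mD : measurable D.
Implicit Types f g h : T -> R.

Definition sqint f :=
  measurable_fun D f /\ mu.-integrable D (fun x => (f x ^+ 2)%:E).

Definition l2form f g := \int[mu]_(x in D) (f x * g x).

Lemma sqint_intM f g : sqint f -> sqint g ->
  mu.-integrable D (fun x => (f x * g x)%:E).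
Proof.
move=> [mf if2] [mg ig2].
have ifg : mu.-integrable D (fun x => (f x ^+ 2 + g x ^+ 2)%:E).
  exact: (integrableD mD if2 ig2).
apply: (le_integrable mD _ _ ifg).
  by apply/measurable_EFinP; exact: measurable_funM.
move=> x _ /=; rewrite lee_fin [leRHS]ger0_norm ?addr_ge0 ?sqr_ge0//.
by rewrite ler_norml; apply/andP; split;
  have := sqr_ge0 (f x + g x); have := sqr_ge0 (f x - g x); nra.
Qed.

Lemma sqint_subspace : subspace sqint.
Proof.
split.
  split; first exact: measurable_cst.
  apply: (eq_integrable mD _ _ _ (integrable0 mu D)) => x _.
  by rewrite /= expr0n.
move=> a f g sf sg; have ifg := sqint_intM _ _ sf sg.
have [[mf if2] [mg ig2]] := (sf, sg); split.
  by apply: measurable_funD => //; exact: measurable_funM.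
have i1 := integrableZl mD (a ^+ 2) if2; have i2 := integrableZl mD (2 * a) ifg.
apply: (eq_integrable mD _ _ _ (integrableD mD i1 (integrableD mD i2 ig2))) => x _.
have -> : (a *: f + g) x = a * f x + g x by [].
by rewrite /= -!EFinM -!EFinD; congr EFin => /=; ring.
Qed.

Lemma l2form_semi_inner : semi_inner sqint l2form.
Proof.
split; first exact: sqint_subspace.
- by move=> f g; apply: eq_Rintegral => x _; rewrite mulrC.
- move=> a f g h sf sg sh; have [ifh igh] := (sqint_intM _ _ sf sh, sqint_intM _ _ sg sh).
  rewrite /l2form -RintegralZl// -RintegralD//; last exact: (integrableZl mD a ifh).
  apply: eq_Rintegral => x _; have -> : (a *: f + g) x = a * f x + g x by [].
  by ring.
- by move=> f; apply: Rintegral_ge0 => x _; rewrite -expr2 sqr_ge0.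
Qed.

Lemma EFin_l2form f g : sqint f -> sqint g ->
  (l2form f g)%:E = (\int[mu]_(x in D) (f x * g x)%:E)%E.
Proof.
move=> sf sg; rewrite fineK//; apply: integrable_fin_num => //.
exact: sqint_intM.
Qed.

Lemma l2form_eq0_ae f : sqint f -> l2form f f = 0 ->
  {ae mu, forall x, D x -> f x = 0}.
Proof.
move=> sf f0; have := EFin_l2form _ _ sf sf; rewrite f0 => /esym i0.
have mf2 : measurable_fun D (fun x => (f x * f x)%:E).
  by apply/measurable_EFinP; apply: measurable_funM; exact: sf.1.
have [+ _] := ae_eq_integral_abs mu mD mf2.
under eq_integral do rewrite /= ger0_norm -?expr2 ?sqr_ge0// expr2.
move=> /(_ i0); apply: filterS => x /= fx Dx; move: (fx Dx) => /= -[] /eqP.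
by rewrite mulf_eq0 orbb => /eqP.
Qed.

(** Used for the multiplication by a coordinate on a bounded domain. *)
Lemma sqint_bounded_mul f g B : measurable_fun D f -> 0 <= B ->
  (forall x, D x -> `|f x| <= B) -> sqint g ->
  sqint (fun x => f x * g x) /\
  l2form (fun x => f x * g x) (fun x => f x * g x) <= B ^+ 2 * l2form g g.
Proof.
move=> mf B0 fB sg; have [mg ig] := sg.
have mfg : measurable_fun D (fun x => f x * g x) by exact: measurable_funM.
have le x : D x -> (f x * g x) ^+ 2 <= B ^+ 2 * g x ^+ 2.
  move=> Dx; rewrite exprMn ler_wpM2r ?sqr_ge0// -subr_ge0 subr_sqr.
  by have := fB _ Dx; rewrite ler_norml => /andP[? ?]; rewrite mulr_ge0//; lra.
have sfg : sqint (fun x => f x * g x).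
  split => //; apply: (le_integrable mD _ _ (integrableZl mD (B ^+ 2) ig)).
    by apply/measurable_EFinP; exact: measurable_funX.
  move=> x Dx /=; rewrite lee_fin [leLHS]ger0_norm ?sqr_ge0//.
  by rewrite (le_trans (le _ Dx))// ler_norm.
split => //; rewrite /l2form -RintegralZl//.
apply: le_Rintegral => //; first exact: sqint_intM.
  exact: (integrableZl mD (B ^+ 2) ig).
Qed.

Lemma bounded_sqint f B : measurable_fun D f -> (mu D < +oo)%E ->
  (forall x, D x -> `|f x| <= B) -> sqint f.
Proof.
move=> mf muD fB; split => //.
apply: measurable_bounded_integrable => //; first exact: measurable_funX.
exists (B ^+ 2); split; first by rewrite num_real.
move=> r Br x /fB xB /=; apply: le_trans (ltW Br).
by rewrite normrX ler_sqr ?nnegrE// (le_trans _ xB).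
Qed.

End SquareIntegrable.

(** * Riesz-Fischer theorem *)

Lemma cvg_of_geometric_steps {R : realType} (a : nat -> R) C :
  (forall k, `|a k.+1 - a k| <= C * 2^-1 ^+ k) -> cvgn a.
Proof.
move=> aC; have sE : a = (fun k => a 0%N + series (fun k => a k.+1 - a k) k).
  by apply/funext => k; rewrite /series /= telescope_sumr// addrC subrK.
rewrite sE; apply: is_cvgD; first exact: is_cvg_cst.
apply: normed_cvg; apply: (@series_le_cvg _ _ (geometric C 2^-1)) => //.
- by move=> k; rewrite normr_ge0.
- by move=> k; rewrite /geometric/=; exact: le_trans (aC k).
- by apply: is_cvg_geometric_series; rewrite ger0_norm//; lra.
Qed.

Section RieszFischer.
Context {d} {T : measurableType d} {R : realType}.
Variables (mu : {measure set T -> \bar R}) (D : set T).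
Hypothesis mD : measurable D.

Let fast k : R := 4^-1 ^+ k * 2^-1 ^+ k.+1.

(** Let [a_k] be the steps.  The weights [4^k] are large enough for the
    boundedness of [4^k (a_k x)^2] to give [|a_k x| <= C 2^-k], and small enough
    for [sum_k 4^k \int a_k^2] to be finite, so that the series
    [sum_k 4^k a_k^2] is integrable and hence finite almost everywhere. *)
Lemma ae_cvg_of_fast_steps (u : nat -> T -> R) :
  (forall k, sqint mu D (u k)) ->
  (forall k, l2form mu D (u k.+1 - u k) (u k.+1 - u k) <= fast k) ->
  {ae mu, forall x, D x -> cvgn (u ^~ x)}.
Proof.
move=> su uq; have sH := sqint_subspace mu D mD.
pose a k := u k.+1 - u k.
have sa k : sqint mu D (a k) by exact: subspaceB.
pose g k x := (4 ^+ k * (a k x * a k x))%:E.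
have mg k : measurable_fun D (g k).
  apply/measurable_EFinP; apply: measurable_funM => //.
  by apply: measurable_funM; exact: (sa k).1.
have g0 k x : D x -> (0 <= g k x)%E.
  by move=> _; rewrite lee_fin mulr_ge0 ?exprn_ge0// -expr2 sqr_ge0.
pose G x := (\sum_(0 <= k <oo) g k x)%E.
have iG : mu.-integrable D G.
  apply/integrableP; split; first by apply: ge0_emeasurable_sum => // k x Dx _; exact: g0.
  under eq_integral => x Dx.
    rewrite gee0_abs; last by apply: nneseries_ge0 => k _ _; exact/g0/set_mem.
    over.
  rewrite integral_nneseries//.
  apply: (@le_lt_trans _ _ (\sum_(0 <= k <oo) (0 + (1 / (2 ^ k.+1)%:R)%:E))%E).
    apply: lee_nneseries => [k _ _|k _].
      by apply: integral_ge0 => x Dx; exact: g0.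
    rewrite add0e /g; under eq_integral do rewrite EFinM.
    rewrite integralZl//; last exact: sqint_intM.
    rewrite -EFin_l2form// -EFinM lee_fin.
    apply: (le_trans (ler_wpM2l _ (uq k))); first by rewrite exprn_ge0.
    by rewrite /fast mulrA -exprMn divff// expr1n !mul1r exprVn natrX.
  apply: le_lt_trans (epsilon_trick _ _ _) _ => //.
  by rewrite eseries0// add0e ltry.
apply: filterS (integrable_ae mD iG) => x Gx Dx; have {Gx}Gx := Gx Dx.
set C := Num.sqrt (fine (G x)).
apply: (@cvg_of_geometric_steps _ _ C) => k.
have : (g k x <= G x)%E.
  apply: le_trans (nneseries_lim_ge k.+1 _); last by move=> *; exact: g0.
  rewrite big_nat_recr//= leeDr//; apply: sume_ge0 => i _; exact: g0.
rewrite -[G x]fineK// lee_fin => gG.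
have -> : 2^-1 ^+ k = Num.sqrt ((4 ^+ k)^-1) :> R.
  rewrite -[2^-1 ^+ k]ger0_norm ?exprn_ge0// -sqrtr_sqr; congr Num.sqrt.
  by rewrite -exprM mulnC exprM -exprVn; congr (_ ^+ _); field.
rewrite -sqrtrM; last first.
  by apply: le_trans gG; rewrite mulr_ge0 ?exprn_ge0// -expr2 sqr_ge0.
rewrite -sqrtr_sqr ler_wsqrtr// ler_pdivlMr ?exprn_gt0// mulrC expr2.
exact: gG.
Qed.

(** A subsequence [u (N k)] with fast steps converges almost everywhere, and
    Fatou's lemma carries the Cauchy rate over to its limit:
    [\int (f - u i)^2 <= liminf_k \int (u (N k) - u i)^2 <= e i]. *)
Lemma riesz_fischer : rate_complete (sqint mu D) (l2form mu D).
Proof.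
move=> u e su e0 ue; have sH := sqint_subspace mu D mD.
have sb := l2form_semi_inner mu D mD.
have fast0 k : 0 < fast k by rewrite mulr_gt0// exprn_gt0.
have /choice[m me] k : exists n, forall i, (n <= i)%N -> e i <= fast k.
  move/cvgrPdist_le : e0 => /(_ _ (fast0 k))[n _ ne]; exists n => i ni.
  by have := ne i ni; rewrite /= sub0r normrN; exact: le_trans (ler_norm _).
(* Summing the thresholds [m i] makes [N] monotone; the successor makes
   [k <= N k]. *)
pose N k := (\sum_(i < k.+1) (m i).+1)%N.
have NS k : (N k <= N k.+1)%N by rewrite /N [leqRHS]big_ord_recr leq_addr.
have kN k : (k <= N k)%N.
  elim: k => // k IHk; rewrite /N big_ord_recr/= addnS ltnS.
  exact: leq_trans IHk (leq_addr _ _).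
have mN k : (m k <= N k)%N by rewrite /N big_ord_recr/= addnS -addSn leq_addl.
have uN : {ae mu, forall x, D x -> cvgn (fun k => u (N k) x)}.
  apply: ae_cvg_of_fast_steps => // k.
  by apply: le_trans (ue _ _ (NS k)) _; exact: me.
(* The upper limit gives a measurable representative of the limit, defined
   also where the subsequence diverges. *)
pose f x := fine (limn_esup (fun k => (u (N k) x)%:E)).
have mf : measurable_fun D f.
  apply: measurableT_comp => //; apply: measurable_fun_limn_esup => k.
  by apply/measurable_EFinP; exact: (su _).1.
have fE : {ae mu, forall x, D x -> u (N k) x @[k --> \oo] --> f x}.
  apply: filterS uN => x cx Dx; have /cvg_ex[l ul] := cx Dx.
  have ulE : (u (N k) x)%:E @[k --> \oo] --> l%:E.
    by apply: cvg_EFin => //; exact: nearW.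
  by rewrite /f (cvg_limn_einf_sup ulE).2.
have fat i : (\int[mu]_(x in D) ((f x - u i x) ^+ 2)%:E <= (e i)%:E)%E.
  pose h k x := ((u (N k) x - u i x) ^+ 2)%:E.
  have mh k : measurable_fun D (h k).
    apply/measurable_EFinP; apply: measurable_funX.
    by apply: measurable_funB; exact: (su _).1.
  have h0 k x : D x -> (0 <= h k x)%E by move=> _; rewrite lee_fin sqr_ge0.
  apply: (@le_trans _ _ (\int[mu]_(x in D) limn_einf (h ^~ x))%E).
    apply: ae_ge0_le_integral => //.
    - by move=> x _; rewrite lee_fin sqr_ge0.
    - apply/measurable_EFinP; apply: measurable_funX.
      by apply: measurable_funB => //; exact: (su _).1.
    - move=> x Dx; rewrite limn_einf_lim; apply: lime_ge.
        exact: is_cvg_einfs.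
      apply: nearW => n; apply: le_ereal_inf_tmp => _ [k _ <-]; exact: h0.
    - rewrite (_ : (fun x => _) = fun x => - limn_esup (fun k => - h k x))%E.
        apply: measurableT_comp => //; apply: measurable_fun_limn_esup => k.
        exact: measurableT_comp.
      apply/funext => x; rewrite -limn_einfN; congr limn_einf.
      by apply/funext => k; exact/esym/oppeK.
    - apply: filterS fE => x fx Dx.
      have hx : h k x @[k --> \oo] --> ((f x - u i x) ^+ 2)%:E.
        apply: cvg_EFin; first exact: nearW.
        have ux : u (N k) x - u i x @[k --> \oo] --> f x - u i x.
          by apply: cvgB; [exact: fx|exact: cvg_cst].
        by under eq_fun do rewrite /h /= expr2; rewrite expr2; exact: cvgM.
      by rewrite (cvg_limn_einf_sup hx).1.
  apply: le_trans (fatou mu mD mh h0) _.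
  rewrite limn_einf_lim; apply: lime_le; first exact: is_cvg_einfs.
  apply: nearW => n; apply: ge_ereal_inf.
  exists (\int[mu]_(x in D) h (maxn n i) x)%E.
    by exists (maxn n i) => //=; exact: leq_maxl.
  have iN : (i <= N (maxn n i))%N by exact: leq_trans (leq_maxr n i) (kN _).
  have := ue _ _ iN; rewrite -lee_fin EFin_l2form//; exact: subspaceB.
have sfu i : sqint mu D (f - u i).
  have mfu : measurable_fun D (f - u i) by apply: measurable_funB => //; exact: (su i).1.
  split=> //; apply/integrableP; split.
    by apply/measurable_EFinP; exact: measurable_funX.
  under eq_integral do rewrite gee0_abs ?lee_fin ?sqr_ge0//.
  by apply: le_lt_trans (fat i) _; rewrite ltry.
have sf : sqint mu D f.
  by rewrite -(subrK (u 0%N) f); apply: subspaceD.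
exists f => //.
apply: (@squeeze_cvg0 _ _ e) => // k; rewrite (si_ge0 _ _ sb)/= (quadC sb)//.
rewrite -lee_fin EFin_l2form//; apply: le_trans (fat k).
by under eq_integral do rewrite -expr2.
Qed.

End RieszFischer.

(** * Borel sets and finite volume in Euclidean space *)

Section Euclidean.
Context {R : realType} {n : nat}.
Implicit Types (f g : 'rV[R]_n -> R) (x y : 'rV[R]_n).

(** The sigma-algebra is generated by the coordinates; an open set is the union
    of the countably many rational boxes that it contains. *)
Lemma open_measurable_rV (O : set 'rV[R]_n) : open O -> measurable O.
Proof.
move=> oO.
pose box (p : 'rV[rat]_n * nat) := [set x : 'rV[R]_n | forall i,
  `]ratr (p.1 ord0 i) - p.2.+1%:R^-1, ratr (p.1 ord0 i) + p.2.+1%:R^-1[%classic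
  (rV_coord i x)].
have mbox p : measurable (box p).
  rewrite (_ : box p = \bigcap_(i in [set: 'I_n]) (rV_coord i @^-1`
      `]ratr (p.1 ord0 i) - p.2.+1%:R^-1, ratr (p.1 ord0 i) + p.2.+1%:R^-1[%classic)).
    apply: fin_bigcap_measurable => // i _.
    by rewrite -[X in measurable X]setTI; apply: measurable_rV_coord.
  by apply/seteqP; split=> x xb i; [move=> _|]; exact: xb.
rewrite (_ : O = \bigcup_p (if `[< box p `<=` O >] then box p else set0)).
  apply: countable_bigcupT_measurable => [|p].
    exact: (@countableP ('rV[rat]_n * nat)%type setT).
  by case: ifP => _; [exact: mbox|exact: measurable0].
apply/seteqP; split=> [x Ox|x [p _]]; last first.
  by case: asboolP => // pO; exact: pO.
have /nbhs_ballP[e /= e0 xeO] := open_nbhs_nbhs (conj oO Ox).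
have [k ke] : exists k, 2 * k.+1%:R^-1 < e :> R.
  exists (Num.truncn (2 / e)); rewrite ltr_pdivrMr// mulrC -ltr_pdivrMr//.
  exact: truncnS_gt.
have : 0 < k.+1%:R^-1 :> R by rewrite invr_gt0.
move: ke; set d := k.+1%:R^-1 => de d0.
have /choice[q qx] (i : 'I_n) : exists r : rat,
    ratr r \in `]x ord0 i - d, x ord0 i + d[.
  by apply: rat_in_itvoo; lra.
exists (\row_i q i, k) => //; case: asboolP => [_ i|].
  rewrite /rV_coord /= in_itv/= mxE -/d; have := qx i; rewrite in_itv/=.
  by move=> /andP[? ?]; apply/andP; split; lra.
case=> y yb; apply: xeO; split => // i j; rewrite ord1 -ball_normE/=.
have := qx j; have := yb j; rewrite /rV_coord /= !in_itv/= mxE -/d.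
by move=> /andP[? ?] /andP[? ?]; rewrite ltr_norml; apply/andP; split; lra.
Qed.

Lemma continuous_measurable_rV f : continuous f -> measurable_fun [set: 'rV[R]_n] f.
Proof.
move=> cf; apply: (measurability _ (RGenOpens.measurableE R)).
move=> _ [_ [a [b ->] <-]]; rewrite setTI; apply: open_measurable_rV.
by apply: open_comp => [x _|]; [exact: cf|exact: interval_open].
Qed.

(** A bounded set lies in a cube, whose volume is a product of lengths. *)
Lemma lebesgue_bounded_lty (A : set 'rV[R]_n) : measurable A -> bounded_set A ->
  (rV_lebesgue A < +oo)%E.
Proof.
move=> mA [B [_ /(_ (B + 1))]]; rewrite ltrDl ltr01 => /(_ isT) AB.
pose I : set (measurableTypeR R) := `[- (B + 1), B + 1]%classic.
have mI : measurable I.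
  exact: measurable_itv.
pose Q := [set x : 'rV[R]_n | forall i, `[- (B + 1), B + 1]%classic (x ord0 i)].
have mQ : measurable Q.
  rewrite (_ : Q = \bigcap_(i in [set: 'I_n]) (rV_coord i @^-1`
      `[- (B + 1), B + 1]%classic)).
    apply: fin_bigcap_measurable => // i _.
    by rewrite -[X in measurable X]setTI; exact: measurable_rV_coord.
  by apply/seteqP; split=> x xb i; [move=> _|]; exact: xb.
apply: (@le_lt_trans _ _ (rV_lebesgue Q)).
  apply: le_measure; rewrite ?inE// => x /AB xB i.
  rewrite /= in_itv/= -ler_norml; apply: le_trans xB.
  rewrite [leRHS]/Num.Def.normr/= mx_normrE.
  by apply/bigmax_geP; right => /=; exists (ord0, i).
have -> : rV_lebesgue Q = (\prod_(i < n) lebesgue_measure I)%E.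
  exact: (@rV_lebesgue_box R n (fun=> I) (fun=> mI)).
rewrite /I lebesgue_measure_itv; set l := (if _ then _ else _).
have l0 : (0 <= l < +oo)%E.
  rewrite /l lte_fin; case: ifP => [BB|_]; last by rewrite lexx ltry.
  by rewrite -EFinD lee_fin ltry andbT; lra.
have [l0' loo] := andP l0; elim/big_rec: _ => [|i z _ zoo]; first by rewrite ltry.
by apply: lte_mul_pinfty => //; rewrite ge0_fin_numE.
Qed.

End Euclidean.

(** * Partial derivatives and test functions *)

Section Calculus.
Context {R : realType} {n : nat}.
Implicit Types (f g : 'rV[R]_n -> R) (x y : 'rV[R]_n) (i : 'I_n).
Local Notation e_ i := (delta_mx ord0 i : 'rV[R]_n).

Lemma is_derive_line f x i : (forall y, derivable f y (e_ i)) -> forall s : R,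
  is_derive s 1 (fun t : R => f (x + t *: e_ i)) (partial i f (x + s *: e_ i)).
Proof.
move=> df s.
have E : (fun h : R => h^-1 *: (((fun t => f (x + t *: e_ i)) \o shift s) (h *: 1)
      - f (x + s *: e_ i))) =
    (fun h : R => h^-1 *: ((f \o shift (x + s *: e_ i)) (h *: e_ i)
      - f (x + s *: e_ i))).
  apply/funext => h /=; congr (_ *: (f _ - _)).
  by rewrite [_ *: 1]mulr1 scalerDl addrCA.
by split; [rewrite /derivable|rewrite /partial /derive] => //=;
  rewrite E //; exact: df.
Qed.

Lemma lipschitz_along f i B : (forall y, derivable f y (e_ i)) ->
  (forall y, `|partial i f y| <= B) ->
  forall x (t : R), `|f (x + t *: e_ i) - f x| <= B * `|t|.
Proof.
move=> df fB x t; wlog t0 : x t / 0 <= t.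
  move=> W; have [/W//|/ltW t0] := leP 0 t.
  have := W (x + t *: e_ i) (- t); rewrite oppr_ge0 => /(_ t0).
  by rewrite -addrA -scalerDl subrr scale0r addr0 normrN distrC.
have dg := is_derive_line f x i df.
have [|s _] := @MVT_segment R (fun t : R => f (x + t *: e_ i)) _ 0 t t0
    (fun s _ => dg s).
  apply: continuous_subspaceT => s.
  apply/differentiable_continuous/derivable1_diffP; case: (dg s) => ds _; exact: ds.
by rewrite scale0r addr0 subr0 => ->; rewrite normrM ler_wpM2r.
Qed.

(** Moving from [y] to [x] one coordinate at a time needs only the mean value
    theorem in one variable, not the differentiability of [f]; the induction is
    on the list of the coordinates already changed. *)
Lemma lipschitz_sum f B : (forall i y, derivable f y (e_ i)) ->
  (forall i y, `|partial i f y| <= B) ->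
  forall x y, `|f x - f y| <= B * \sum_i `|x ord0 i - y ord0 i|.
Proof.
move=> df fB x y.
suff W (s : seq 'I_n) (c : 'I_n -> R) z :
    `|f (z + \sum_(i <- s) c i *: e_ i) - f z| <= B * \sum_(i <- s) `|c i|.
  have := W (index_enum 'I_n) (fun i => x ord0 i - y ord0 i) y.
  rewrite (_ : y + _ = x)// -[RHS](addrNK y) addrC; congr (_ + _).
  by rewrite [RHS]row_sum_delta; apply: eq_bigr => i _; rewrite !mxE.
elim: s z => [|i s IHs] z; first by rewrite !big_nil addr0 subrr normr0 mulr0.
rewrite !big_cons addrA mulrDr; set z' := z + _.
apply: le_trans (_ : `|f (z' + \sum_(j <- s) c j *: e_ j) - f z'| +
  `|f z' - f z| <= _).
  by rewrite (le_trans _ (ler_normD _ _))// addrA subrK.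
by rewrite addrC lerD//; exact: lipschitz_along.
Qed.

Lemma partial_lin a f g i : (forall y, derivable f y (e_ i)) ->
  (forall y, derivable g y (e_ i)) ->
  (forall y, derivable (a *: f + g) y (e_ i)) /\
  partial i (a *: f + g) = a *: partial i f + partial i g.
Proof.
move=> df dg; split=> [y|].
  by apply: derivableD => //; exact: derivableZ.
apply/funext => y; rewrite /partial deriveD//; last exact: derivableZ.
by rewrite deriveZ.
Qed.

Lemma classC_lin k a f g : classC k f -> classC k g -> classC k (a *: f + g).
Proof.
have clin (u v : 'rV[R]_n -> R) : continuous u -> continuous v ->
    continuous (a *: u + v).
  move=> cu cv x; apply: continuousD; last exact: cv.
  by apply: continuousZl_tmp; exact: cu.
elim: k f g => [|k IHk] f g /= [cf df] [cg dg]; split => //; try exact: clin.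
move=> i; have [[dfi fi] [dgi gi]] := (df i, dg i).
have [d ->] := partial_lin a f g i dfi dgi.
by split; [exact: d|exact: IHk].
Qed.

Lemma partial_coord i j : partial j (fun x : 'rV[R]_n => x ord0 i) = cst (i == j)%:R.
Proof.
apply/funext => x; rewrite /partial /derive; apply: cvg_lim => //.
apply: (@cvg_trans _ ((cst (i == j)%:R : R -> R) @ 0^')); last exact: cvg_cst.
apply: near_eq_cvg; near=> h.
rewrite /= !mxE eqxx addrK [_ *: _]mulrA mulVf ?mul1r//.
by near: h; exact: nbhs_dnbhs_neq.
Unshelve. all: end_near. Qed.

Lemma partial_coordM f i j : (forall y, derivable f y (e_ j)) ->
  (forall y, derivable (fun x => x ord0 i * f x) y (e_ j)) /\
  partial j (fun x => x ord0 i * f x) =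
    (fun x => x ord0 i * partial j f x + (i == j)%:R * f x).
Proof.
move=> df.
have dc y : derivable (fun x : 'rV[R]_n => x ord0 i : R) y (e_ j).
  exact/diff_derivable/differentiable_coord.
split=> [y|]; first exact: (derivableM (dc y)).
apply/funext => y; rewrite /partial (deriveM (dc y))//.
have := congr1 (@^~ y) (partial_coord i j); rewrite /partial /= => ->.
by rewrite [f y *: _]mulrC.
Qed.

(** The derivative of [x_i g] is [x_i g'] plus a multiple of [g], so the
    induction on the order must be run on functions of the form [x_i g + h]
    with [g] and [h] smooth. *)
Lemma smooth_coordM f i :
  (forall k, classC k f) -> forall k, classC k (fun x => x ord0 i * f x).
Proof.
suff W k g h : (forall m, classC m g) -> (forall m, classC m h) ->
    classC k (1 *: (fun x => x ord0 i * g x) + h).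
  move=> sf k; have := W k f (0 *: f) sf.
  rewrite scale1r scale0r addr0; apply => m.
  have := classC_lin m (-1) _ _ (sf m) (sf m).
  by rewrite scaleN1r addNr.
have cM' u v : continuous u -> continuous v ->
    continuous (1 *: (fun x : 'rV[R]_n => x ord0 i * u x) + v).
  move=> cu cv; rewrite scale1r => x; apply: continuousD; last exact: cv.
  by apply: continuousM; [exact: coord_continuous|exact: cu].
elim: k g h => [|k IHk] g h sg sh.
  by split => //; exact: (cM' _ _ (sg 0%N).1 (sh 0%N).1).
split=> [|j]; first exact: (cM' _ _ (sg 0%N).1 (sh 0%N).1).
have dg y : derivable g y (e_ j) by exact: ((sg 1%N).2 j).1.
have dh y : derivable h y (e_ j) by exact: ((sh 1%N).2 j).1.
have [dM pM] := partial_coordM g i j dg.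
have [dl ->] := partial_lin 1 _ h j dM dh; split; first exact: dl.
rewrite pM.
have -> : 1 *: (fun x => x ord0 i * partial j g x + (i == j)%:R * g x) + partial j h
    = 1 *: (fun x => x ord0 i * partial j g x) + ((i == j)%:R *: g + partial j h).
  by rewrite !scale1r addrA.
apply: IHk => m; first exact: ((sg m.+1).2 j).2.
by apply: classC_lin; [exact: sg|exact: ((sh m.+1).2 j).2].
Qed.

Lemma test_function_coordM (Omega : set 'rV[R]_n) f i :
  test_function Omega f -> test_function Omega (fun x => x ord0 i * f x).
Proof.
move=> [sf [K [cK KO fK]]]; split; first exact: smooth_coordM.
by exists K; split => // x /fK ->; rewrite mulr0.
Qed.

Lemma test_function_partial (Omega : set 'rV[R]_n) f :
  test_function Omega f -> forall i y, derivable f y (e_ i).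
Proof. by move=> [sf _] i y; exact: ((sf 1%N).2 i).1. Qed.

Lemma test_function_subspace (Omega : set 'rV[R]_n) :
  subspace (test_function Omega).
Proof.
split; [split; last by exists set0; split=> //; exact: compact0|].
  elim=> [|k IHk]; split=> //; try exact: cst_continuous.
  move=> i; split=> [x|]; first exact: (derivable_cst (0 : R)).
  rewrite (_ : partial i 0 = 0)//; apply/funext => x.
  exact: (derive_cst (0 : R)).
move=> a f g [sf [K [cK KO fK]]] [sg [L [cL LO gL]]]; split.
  by move=> k; exact: classC_lin.
exists (K `|` L); split; [exact: compactU|by rewrite subUset|].
move=> x KLx; have -> : (a *: f + g) x = a * f x + g x by [].
by rewrite fK ?gL ?mulr0 ?addr0// => Kx; apply: KLx; [right|left].
Qed.

Lemma grad_lin (a : R) f g : (forall i y, derivable f y (e_ i)) ->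
  (forall i y, derivable g y (e_ i)) -> grad (a *: f + g) = a *: grad f + grad g.
Proof.
move=> df dg; apply/funext => x; apply/rowP => i.
rewrite mxE (partial_lin a f g i (df i) (dg i)).2.
by rewrite -[RHS]/((a *: grad f x + grad g x) ord0 i) !mxE.
Qed.

End Calculus.

(** * Square-integrable vector fields and the Sobolev form *)

Lemma semi_innerS {R : realType} {V : lmodType R} (H H' : set V) b :
  subspace H' -> H' `<=` H -> semi_inner H b -> semi_inner H' b.
Proof.
by move=> sH' HH' [_ sym lin ge0]; split => // a u v w Hu Hv Hw;
  apply: lin; exact: HH'.
Qed.

Lemma enorm_sqr {R : realType} {n : nat} (a : 'rV[R]_n) : enorm a ^+ 2 = dotp a a.
Proof.
rewrite /enorm big_ord1 sqr_sqrtr; last by apply: sumr_ge0 => i _; exact: sqr_ge0.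
by apply: eq_bigr => i _; rewrite expr2.
Qed.

Section VectorFields.
Context {d} {T : measurableType d} {R : realType} {n : nat}.
Variables (mu : {measure set T -> \bar R}) (D : set T).
Hypothesis mD : measurable D.
Implicit Types F G H : T -> 'rV[R]_n.

Definition sqintv F := forall i, sqint mu D (fun x => F x ord0 i).

Definition l2vec F G := \int[mu]_(x in D) dotp (F x) (G x).

(** Integrability and the splitting into coordinates are proved together
    because additivity of the integral needs integrability of each term. *)
Lemma l2vec_sum F G : sqintv F -> sqintv G ->
  mu.-integrable D (fun x => (dotp (F x) (G x))%:E) /\
  l2vec F G = \sum_i l2form mu D (fun x => F x ord0 i) (fun x => G x ord0 i).
Proof.
move=> sF sG; rewrite /l2vec /dotp.
elim: (index_enum _) => [|i s [ints IHs]].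
  split.
    by apply: (eq_integrable mD _ _ _ (integrable0 mu D)) => x _; rewrite big_nil.
  under eq_Rintegral do rewrite big_nil; rewrite big_nil.
  by rewrite Rintegral_cst// mul0r.
have inti := sqint_intM mu D mD _ _ (sF i) (sG i); split.
  apply: (eq_integrable mD _ _ _ (integrableD mD inti ints)) => x _.
  by rewrite big_cons.
rewrite big_cons -IHs -RintegralD//.
by apply: eq_Rintegral => x _; rewrite big_cons.
Qed.

Lemma dotp_integrable F G : sqintv F -> sqintv G ->
  mu.-integrable D (fun x => (dotp (F x) (G x))%:E).
Proof. by move=> sF sG; exact: (l2vec_sum _ _ sF sG).1. Qed.

Lemma l2vecE F G : sqintv F -> sqintv G ->
  l2vec F G = \sum_i l2form mu D (fun x => F x ord0 i) (fun x => G x ord0 i).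
Proof. by move=> sF sG; exact: (l2vec_sum _ _ sF sG).2. Qed.

Lemma l2vec_semi_inner : semi_inner sqintv l2vec.
Proof.
have sb := l2form_semi_inner mu D mD; have [s0 sl] := si_sub _ _ sb.
have ssv : subspace sqintv.
  split=> [i|a F G sF sG i].
    by rewrite (_ : (fun x => _) = 0)//; apply/funext => x; rewrite mxE.
  rewrite (_ : (fun x => _) = a *: (fun x => F x ord0 i) + (fun x => G x ord0 i)).
    exact: sl.
  by apply/funext => x; rewrite -[LHS]/((a *: F x + G x) ord0 i) !mxE.
split=> //.
- by move=> F G; apply: eq_Rintegral => x _; apply: eq_bigr => i _; rewrite mulrC.
- move=> a F G H sF sG sH; rewrite !l2vecE//; last exact: ssv.2.
  rewrite mulr_sumr -big_split; apply: eq_bigr => i _ /=.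
  rewrite -(si_lin _ _ sb)//; congr l2form.
  by apply/funext => x; rewrite -[LHS]/((a *: F x + G x) ord0 i) !mxE.
- by move=> F; apply: Rintegral_ge0 => x _; rewrite -enorm_sqr sqr_ge0.
Qed.

Definition sqint_pair (u : (T -> R) * (T -> 'rV[R]_n)) := sqint mu D u.1 /\ sqintv u.2.

(** The [H1] inner product; its quadratic form is [H1_normsq]. *)
Definition h1form (u v : (T -> R) * (T -> 'rV[R]_n)) :=
  l2form mu D u.1 v.1 + l2vec u.2 v.2.

Lemma h1form_semi_inner : semi_inner sqint_pair h1form.
Proof.
have [[s0 sl] sym lin ge0] := l2form_semi_inner mu D mD.
have [[vs0 vsl] vsym vlin vge0] := l2vec_semi_inner.
split.
- by split=> [|a u v [? ?] [? ?]]; split; [exact: s0|exact: vs0|exact: sl|exact: vsl].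
- by move=> u v; rewrite /h1form sym vsym.
- move=> a u v w [? ?] [? ?] [? ?]; rewrite /h1form lin// vlin//.
  by rewrite mulrDr addrACA.
- by move=> u; rewrite addr_ge0.
Qed.

Lemma grad_form_semi_inner : semi_inner sqint_pair (fun u v => l2vec u.2 v.2).
Proof.
have [[vs0 vsl] vsym vlin vge0] := l2vec_semi_inner.
split=> //; first exact: si_sub h1form_semi_inner.
by move=> a u v w [? ?] [? ?] [? ?]; exact: vlin.
Qed.

(** Each component of a Cauchy sequence is Cauchy for the same rate, since its
    [L^2] norm is dominated by the full norm. *)
Lemma h1form_complete : rate_complete sqint_pair h1form.
Proof.
move=> u e su e0 ue; have sb := l2form_semi_inner mu D mD.
have sbv := l2vec_semi_inner; have sH := si_sub _ _ h1form_semi_inner.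
have [||j k /ue|f sf uf] := riesz_fischer mu D mD (fun k => (u k).1) e.
- by move=> k; exact: (su k).1.
- exact: e0.
- by apply: le_trans; rewrite lerDl (si_ge0 _ _ sbv).
have /choice[g gP] i : exists g, sqint mu D g /\
    l2form mu D ((fun x => (u k).2 x ord0 i) - g) ((fun x => (u k).2 x ord0 i) - g)
      @[k --> \oo] --> (0 : R).
  have [||j k jk|g sg ug] :=
    riesz_fischer mu D mD (fun k x => (u k).2 x ord0 i) e; last by exists g.
  - by move=> k; exact: (su k).2.
  - exact: e0.
  - have [_ sd] : sqint_pair (u j - u k) by exact: subspaceB.
    apply: le_trans (ue _ _ jk); rewrite /h1form l2vecE// (bigD1 i)//= addrCA.
    rewrite (_ : (fun x => (u j).2 x ord0 i) - _ = fun x => (u j - u k).2 x ord0 i).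
      by rewrite lerDl addr_ge0 ?sumr_ge0// => *; exact: si_ge0 sb _.
    by apply/funext => x; rewrite -[RHS]/(((u j).2 x - (u k).2 x) ord0 i) !mxE.
pose l : (T -> R) * (T -> 'rV[R]_n) := (f, fun x => \row_i g i x).
have sl : sqint_pair l.
  split=> // i; rewrite (_ : (fun x => _) = g i); first exact: (gP i).1.
  by apply/funext => x; rewrite mxE.
exists l => //; rewrite -[X in _ --> X]addr0; apply: cvgD; first exact: uf.
have -> : (fun k => l2vec (u k - l).2 (u k - l).2) = fun k => \sum_i
    l2form mu D ((fun x => (u k).2 x ord0 i) - g i) ((fun x => (u k).2 x ord0 i) - g i).
  apply/funext => k; have [_ sd] : sqint_pair (u k - l) by exact: subspaceB.
  rewrite l2vecE//; apply: eq_bigr => i _.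
  rewrite (_ : (fun x => (u k - l).2 x ord0 i) = (fun x => (u k).2 x ord0 i) - g i)//.
  by apply/funext => x; rewrite -[LHS]/(((u k).2 x - l.2 x) ord0 i) !mxE.
elim: (index_enum _) => [|i s IHs].
  by under eq_fun do rewrite big_nil; exact: cvg_cst.
under eq_fun do rewrite big_cons.
by have := cvgD (gP i).2 IHs; rewrite addr0; apply.
Qed.

End VectorFields.

(** * The spaces H1 and H10 *)

Section Sobolev.
Context {R : realType} {n : nat} {Omega : set 'rV[R]_n}.
Hypothesis oO : open Omega.
Hypothesis bO : bounded_set Omega.
Implicit Types (u v w : sob R n) (phi : 'rV[R]_n -> R).

Local Notation leb := (@rV_lebesgue R n).
Local Notation ip := (l2form leb Omega).
Local Notation ipv := (l2vec leb Omega).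
Local Notation h1 := (h1form leb Omega).
Local Notation L2pair := (sqint_pair leb Omega).

Let mO : measurable Omega := open_measurable_rV Omega oO.
Let sb := l2form_semi_inner leb Omega mO.
Let sbv := l2vec_semi_inner leb Omega mO (n := n).
Let sbh := h1form_semi_inner leb Omega mO (n := n).

Lemma coord_bounded : exists2 B : R, 0 <= B &
  forall x, Omega x -> forall i, `|x ord0 i| <= B.
Proof.
case: bO => B [_ /(_ (`|B| + 1))]; rewrite ltr_pwDr ?ler_norm// => /(_ isT) OB.
exists (`|B| + 1) => [|x /OB xB i]; first by rewrite addr_ge0.
apply: le_trans xB; rewrite [leRHS]/Num.Def.normr/= mx_normrE.
by apply/bigmax_geP; right => /=; exists (ord0, i).
Qed.

Lemma continuous_L2 f : continuous f -> sqint leb Omega f.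
Proof.
move=> cf; have [B B0 OB] := coord_bounded.
pose Q := [set x : 'rV[R]_n | forall i, `[- B, B]%classic (x ord0 i)].
have cQ : compact Q.
  by apply: (@rV_compact R n (fun=> `[- B, B]%classic)) => i; exact: segment_compact.
have [C [_ /(_ (C + 1))]] :=
  compact_bounded (continuous_compact (continuous_subspaceT cf) cQ).
rewrite ltrDl ltr01 => /(_ isT) QC.
apply: (bounded_sqint leb Omega mO f (C + 1)).
- exact: measurable_funTS (continuous_measurable_rV f cf).
- exact: lebesgue_bounded_lty.
- move=> x Ox; apply: QC; exists x => // i /=.
  by rewrite in_itv/= -ler_norml; exact: OB.
Qed.

Lemma test_function_L2 phi : test_function Omega phi ->
  sqint leb Omega phi /\ forall i, sqint leb Omega (partial i phi).
Proof.
move=> [sf _]; split; first exact: continuous_L2 (sf 0%N).1.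
by move=> i; exact: continuous_L2 ((sf 1%N).2 i).2.1.
Qed.

Lemma test_function_L2pair phi : test_function Omega phi -> L2pair (phi, grad phi).
Proof.
move=> /test_function_L2[sphi spphi]; split=> // i.
by rewrite (_ : (fun x => _) = partial i phi)//; apply/funext => x; rewrite mxE.
Qed.

Lemma H1_normsqE w : H1_normsq Omega w = h1 w w.
Proof.
rewrite /H1_normsq /h1form; congr (_ + _); apply: eq_Rintegral => x _.
exact: enorm_sqr.
Qed.

Lemma H1_L2pair u : H1 Omega u -> L2pair u. Proof. by case. Qed.

Lemma H1_weak u phi i : H1 Omega u -> test_function Omega phi ->
  ip u.1 (partial i phi) = - ip (fun x => u.2 x ord0 i) phi.
Proof. by case=> _ _; apply. Qed.

Lemma H1_subspace : subspace (H1 Omega).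
Proof.
have [L0 Ll] := si_sub _ _ sbh.
split=> [|a u v Hu Hv].
  have [s0 sv0] := L0; split=> // phi i /test_function_L2[sphi spphi].
  rewrite -[LHS]/(ip 0 (partial i phi)) (form0l sb)//.
  rewrite -[X in - X]/(ip (fun x => (0 : sob R n).2 x ord0 i) phi).
  rewrite (_ : (fun x => (0 : sob R n).2 x ord0 i) = 0); last first.
    by apply/funext => x; rewrite -[LHS]/((0 : 'rV[R]_n) ord0 i) mxE.
  by rewrite (form0l sb)// oppr0.
have [Lu Lv] := (H1_L2pair u Hu, H1_L2pair v Hv).
have [s sv] := Ll a u v Lu Lv; split=> // phi i tphi.
have [sphi spphi] := test_function_L2 phi tphi.
rewrite -[LHS]/(ip (a *: u.1 + v.1) (partial i phi)).
rewrite (si_lin _ _ sb)//; [|exact: Lu.1|exact: Lv.1].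
rewrite !H1_weak// -[RHS]/(- ip (fun x => (a *: u + v).2 x ord0 i) phi).
rewrite (_ : (fun x => (a *: u + v).2 x ord0 i) =
    a *: (fun x => u.2 x ord0 i) + (fun x => v.2 x ord0 i)); last first.
  by apply/funext => x; rewrite -[LHS]/((a *: u.2 x + v.2 x) ord0 i) !mxE.
rewrite (si_lin _ _ sb)//; [|exact: Lu.2|exact: Lv.2].
by rewrite opprD mulrN.
Qed.

Lemma h1_approx_lin (a : R) u v phi psi : L2pair u -> L2pair v ->
  test_function Omega phi -> test_function Omega psi ->
  h1 (a *: u + v - (a *: phi + psi, grad (a *: phi + psi)))
     (a *: u + v - (a *: phi + psi, grad (a *: phi + psi))) <=
  2 * (a ^+ 2 * h1 (u - (phi, grad phi)) (u - (phi, grad phi)) +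
       h1 (v - (psi, grad psi)) (v - (psi, grad psi))).
Proof.
move=> Lu Lv tphi tpsi; have sH := si_sub _ _ sbh.
have [Lphi Lpsi] := (test_function_L2pair _ tphi, test_function_L2pair _ tpsi).
rewrite (grad_lin a); last 2 first.
- exact: test_function_partial tphi.
- exact: test_function_partial tpsi.
have -> : a *: u + v - (a *: phi + psi, a *: grad phi + grad psi) =
    (0 + a *: (u - (phi, grad phi))) + (v - (psi, grad psi)).
  by rewrite add0r scalerBr addrACA -opprD.
have Lu' : L2pair (u - (phi, grad phi)) by exact: subspaceB.
have Lv' : L2pair (v - (psi, grad psi)) by exact: subspaceB.
apply: le_trans (quad_leD sbh _ _ _ Lv') _.
  by rewrite add0r; exact: subspaceZ.
rewrite (quadD sbh)//; last exact: sH.1.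
by rewrite !(form0l sbh) ?mulr0 ?add0r//; exact: sH.1.
Qed.

(** With [H10_of_cvg], the sequential form of the closure of the test functions
    in [H1]. *)
Lemma H10_approx w : H10 Omega w -> exists phi : nat -> 'rV[R]_n -> R,
  (forall k, test_function Omega (phi k)) /\
  h1 (w - (phi k, grad (phi k))) (w - (phi k, grad (phi k))) @[k --> \oo] --> (0 : R).
Proof.
move=> [_ wphi].
have /choice[phi phiP] k : exists phi, test_function Omega phi /\
    h1 (w - (phi, grad phi)) (w - (phi, grad phi)) < k.+1%:R^-1.
  have [|phi tphi] := wphi k.+1%:R^-1; first by rewrite invr_gt0.
  by rewrite H1_normsqE => ?; exists phi.
exists phi; split=> [k|]; first exact: (phiP k).1.
apply: (@squeeze_cvg0 _ _ (fun k => k.+1%:R^-1)); last exact: cvg_harmonic.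
by move=> k; rewrite (si_ge0 _ _ sbh) ltW//; exact: (phiP k).2.
Qed.

Lemma H10_of_cvg w (phi : nat -> 'rV[R]_n -> R) : H1 Omega w ->
  (forall k, test_function Omega (phi k)) ->
  h1 (w - (phi k, grad (phi k))) (w - (phi k, grad (phi k))) @[k --> \oo] --> (0 : R) ->
  H10 Omega w.
Proof.
move=> Hw tphi /cvgrPdist_lt wphi; split=> // eps /wphi[k _ /(_ k)].
rewrite /= leqnn => /(_ isT); rewrite sub0r normrN => wk.
by exists (phi k) => //; rewrite H1_normsqE; exact: le_lt_trans (ler_norm _) wk.
Qed.

Lemma H10_subspace : subspace (H10 Omega).
Proof.
have [H0 Hl] := H1_subspace; have [t0 tl] := test_function_subspace Omega.
split=> [|a u v Hu Hv].
  split=> // eps eps0; exists 0 => //; rewrite H1_normsqE.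
  have -> : 0 - (0, grad 0) = 0 :> sob R n.
    have := @grad_lin _ _ (-1) 0 0 (test_function_partial _ _ t0)
      (test_function_partial _ _ t0).
    by rewrite scaler0 addr0 scaleN1r addNr => ->; rewrite subr0.
  by rewrite (form0l sbh)//; exact: (si_sub _ _ sbh).1.
have [phi [tphi uphi]] := H10_approx u Hu.
have [psi [tpsi vpsi]] := H10_approx v Hv.
have [Lu Lv] := (H1_L2pair u Hu.1, H1_L2pair v Hv.1).
apply: (H10_of_cvg _ (fun k => a *: phi k + psi k)).
- by apply: Hl; [exact: Hu.1|exact: Hv.1].
- by move=> k; exact: tl.
- apply: (@squeeze_cvg0 _ _ (fun k => 2 *
      (a ^+ 2 * h1 (u - (phi k, grad (phi k))) (u - (phi k, grad (phi k))) +
       h1 (v - (psi k, grad (psi k))) (v - (psi k, grad (psi k)))))) => [k|].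
    by rewrite (si_ge0 _ _ sbh)/=; exact: h1_approx_lin.
  apply: cvg0Ml; exact: (cvg0D _ _ (cvg0Ml _ _ uphi) vpsi).
Qed.

End Sobolev.

(** * Poincare inequality and completeness of H10 *)

Section SobolevHilbert.
Context {R : realType} {n : nat} {Omega : set 'rV[R]_n}.
Hypothesis oO : open Omega.
Hypothesis bO : bounded_set Omega.
Implicit Types (u v w : sob R n) (phi : 'rV[R]_n -> R).

Local Notation leb := (@rV_lebesgue R n).
Local Notation ip := (l2form leb Omega).
Local Notation ipv := (l2vec leb Omega).
Local Notation h1 := (h1form leb Omega).
Local Notation L2pair := (sqint_pair leb Omega).

Let mO : measurable Omega := open_measurable_rV Omega oO.
Let sb := l2form_semi_inner leb Omega mO.
Let sbv := l2vec_semi_inner leb Omega mO (n := n).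
Let sbh := h1form_semi_inner leb Omega mO (n := n).

Lemma l2form_comp_le (F : 'rV[R]_n -> 'rV[R]_n) i : sqintv leb Omega F ->
  ip (fun x => F x ord0 i) (fun x => F x ord0 i) <= ipv F F.
Proof.
move=> sF; rewrite l2vecE// (bigD1 i)//= lerDl.
by apply: sumr_ge0 => j _; exact: si_ge0 sb _.
Qed.

(** Passage to the limit in the integrals that define weak gradients and in the
    identity behind [poincare]. *)
Lemma h1_cvg_weak (z : nat -> sob R n) w : (forall k, L2pair (z k)) -> L2pair w ->
  h1 (z k - w) (z k - w) @[k --> \oo] --> (0 : R) ->
  (forall g, sqint leb Omega g -> ip (z k).1 g @[k --> \oo] --> ip w.1 g) /\
  (forall i g, sqint leb Omega g ->
     ip (fun x => (z k).2 x ord0 i) g @[k --> \oo] --> ip (fun x => w.2 x ord0 i) g).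
Proof.
move=> Lz Lw zw; have sH := si_sub _ _ sbh.
have Ld k : L2pair (z k - w) by exact: subspaceB.
split=> [g sg|i g sg].
- apply: (form_cvg sb) => // [k||].
  + exact: (Lz k).1.
  + exact: Lw.1.
  + apply: (squeeze_cvg0 _ _ _ zw) => k; rewrite (si_ge0 _ _ sb)/= /h1form.
    by rewrite lerDl (si_ge0 _ _ sbv).
- apply: (form_cvg sb) => // [k||].
  + exact: (Lz k).2.
  + exact: Lw.2.
  + apply: (squeeze_cvg0 _ _ _ zw) => k; rewrite (si_ge0 _ _ sb)/= /h1form.
    have := l2form_comp_le _ i (Ld k).2.
    rewrite (_ : (fun x => (z k - w).2 x ord0 i) =
      (fun x => (z k).2 x ord0 i) - (fun x => w.2 x ord0 i)); last first.
      by apply/funext => x; rewrite -[LHS]/(((z k).2 x - w.2 x) ord0 i) !mxE.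
    move=> /le_trans; apply.
    by rewrite lerDr (si_ge0 _ _ sb).
Qed.

(** Let [g] be the [i]-th component of the weak gradient of [w], and [phi_k] test
    functions converging to [w].  The test function [x_i phi_k] has derivative
    [x_i (phi_k)' + phi_k], so the weak gradient identity for [w] reads
    [\int w phi_k + \int x_i w (phi_k)' + \int x_i g phi_k = 0].  In the limit
    [\int w^2 = - 2 \int w x_i g], and the Cauchy-Schwarz inequality gives
    [\int w^2 <= 4 B^2 \int g^2] when [|x_i| <= B] on [Omega]. *)
Lemma poincare : (0 < n)%N -> exists2 C : R, 0 <= C &
  forall w, H10 Omega w -> h1 w w <= C * ipv w.2 w.2.
Proof.
move=> n0; pose i := Ordinal n0; have [B B0 OB] := coord_bounded bO.
exists (4 * B ^+ 2 + 1) => [|w Hw].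
  by rewrite addr_ge0 ?mulr_ge0 ?sqr_ge0.
have [phi [tphi wphi]] := H10_approx oO w Hw.
have [Lw sH] := (H1_L2pair _ Hw.1, si_sub _ _ sbh).
have [sw sg] := (Lw.1, Lw.2 i).
pose g x := w.2 x ord0 i; pose xi (x : 'rV[R]_n) := x ord0 i.
have mxi : measurable_fun Omega xi by exact: (measurable_funTS (measurable_rV_coord i)).
have xiB x : Omega x -> `|xi x| <= B by move=> Ox; exact: OB.
have [sxw _] := sqint_bounded_mul leb Omega mO xi w.1 B mxi B0 xiB sw.
have [sxg xgB] := sqint_bounded_mul leb Omega mO xi g B mxi B0 xiB sg.
have Lphi k : L2pair (phi k, grad (phi k)) by exact: test_function_L2pair.
have phiw : h1 ((phi k, grad (phi k)) - w) ((phi k, grad (phi k)) - w)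
    @[k --> \oo] --> (0 : R).
  by under eq_fun do rewrite (quadC sbh)//; exact: wphi.
have [c1 c2] := h1_cvg_weak _ _ Lphi Lw phiw.
have zero k : ip (phi k) w.1 + ip (fun x => grad (phi k) x ord0 i) (fun x => xi x * w.1 x)
    + ip (phi k) (fun x => xi x * g x) = 0.
  have [sphi spphi] := test_function_L2 oO bO _ (tphi k).
  have txphi := test_function_coordM _ _ i (tphi k).
  have := H1_weak w _ i Hw.1 txphi.
  have -> : partial i (fun x : 'rV[R]_n => x ord0 i * phi k x) =
      1 *: (fun x : 'rV[R]_n => x ord0 i * partial i (phi k) x) + phi k.
    rewrite (partial_coordM _ i i (test_function_partial _ _ (tphi k) i)).2.
    by apply/funext => x; rewrite eqxx scale1r mul1r.
  have sxp : sqint leb Omega (fun x : 'rV[R]_n => x ord0 i * partial i (phi k) x).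
    exact: (sqint_bounded_mul leb Omega mO xi _ B mxi B0 xiB (spphi i)).1.
  rewrite (si_sym _ _ sb) (si_lin _ _ sb)// mul1r => E.
  have -> : ip (fun x => grad (phi k) x ord0 i) (fun x => xi x * w.1 x) =
      ip (fun x : 'rV[R]_n => x ord0 i * partial i (phi k) x) w.1.
    by apply: eq_Rintegral => x _; rewrite mxE /xi; ring.
  have -> : ip (phi k) (fun x => xi x * g x) =
      ip (fun x => w.2 x ord0 i) (fun x : 'rV[R]_n => x ord0 i * phi k x).
    by apply: eq_Rintegral => x _; rewrite /xi /g; ring.
  by rewrite addrC [X in _ + X]addrC E addrN.
have lim : ip w.1 w.1 + ip g (fun x => xi x * w.1 x) + ip w.1 (fun x => xi x * g x) = 0.
  have c : ip (phi k) w.1 + ip (fun x => grad (phi k) x ord0 i) (fun x => xi x * w.1 x)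
      + ip (phi k) (fun x => xi x * g x) @[k --> \oo] -->
      ip w.1 w.1 + ip g (fun x => xi x * w.1 x) + ip w.1 (fun x => xi x * g x).
    apply: cvgD; last exact: c1.
    by apply: cvgD; [exact: c1|exact: c2].
  have c' : (0 : R) @[k --> \oo] --> (0 : R) by exact: cvg_cst.
  have E := funext zero; rewrite E in c.
  exact: (norm_cvg_unique c c').
have gw : ip g (fun x => xi x * w.1 x) = ip w.1 (fun x => xi x * g x).
  by apply: eq_Rintegral => x _; ring.
rewrite gw in lim.
have cs := cauchy_schwarz sb _ _ sw sxg.
have gle := l2form_comp_le w.2 i Lw.2.
have w0 := si_ge0 _ _ sb w.1.
rewrite /h1form mulrDl mul1r lerD2r.
move: lim cs xgB gle w0; set Q := ip w.1 w.1; set Z := ip w.1 (fun _ => _).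
set X := ip (fun _ => _) _; rewrite -/g; set P := ip g g; set G := ipv _ _.
move=> lim cs xgB gle; rewrite le_eqVlt => /predU1P[<-|Q0].
  by rewrite mulr_ge0 ?mulr_ge0 ?sqr_ge0// (le_trans _ gle)// (si_ge0 _ _ sb).
rewrite -(ler_pM2l Q0); have ZE : Z = - 2^-1 * Q by lra.
have BG : B ^+ 2 * P <= B ^+ 2 * G by rewrite ler_wpM2l ?sqr_ge0.
have : Q * X <= Q * (B ^+ 2 * G) by rewrite ler_pM2l//; exact: le_trans xgB BG.
by move: cs; rewrite ZE; nra.
Qed.

(** By [poincare] a sequence that is Cauchy for the gradients is Cauchy in [H1];
    its [L^2] limit still satisfies the weak gradient identity, and a diagonal
    choice of test functions approximates it. *)
Lemma H10_grad_complete : (0 < n)%N ->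
  rate_complete (H10 Omega) (fun u v => ipv u.2 v.2).
Proof.
move=> n0 u e Hu e0 ue; have [C C0 CP] := poincare n0.
have sH := H10_subspace oO bO.
have Lu k : L2pair (u k) by exact: H1_L2pair (Hu k).1.
have [||j k jk|l Ll ul] := h1form_complete leb Omega mO u (fun k => C * e k).
- exact: Lu.
- exact: cvg0Ml.
- have Hd : H10 Omega (u j - u k) by exact: subspaceB.
  apply: le_trans (CP _ Hd) _; rewrite ler_wpM2l//; exact: ue.
have [ul1 ul2] := h1_cvg_weak u l Lu Ll ul.
have Hl : H1 Omega l.
  split; [exact: Ll.1|exact: Ll.2|move=> phi i tphi].
  have [sphi spphi] := test_function_L2 oO bO phi tphi.
  have c1 := ul1 _ (spphi i); have c2 : - ip (fun x => (u k).2 x ord0 i) phi @[k --> \oo]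
      --> - ip (fun x => l.2 x ord0 i) phi by apply: cvgN; exact: ul2.
  have E : (fun k => ip (u k).1 (partial i phi)) =
      (fun k => - ip (fun x => (u k).2 x ord0 i) phi).
    by apply/funext => k; exact: H1_weak (Hu k).1 tphi.
  rewrite E in c1; exact: norm_cvg_unique c1 c2.
exists l; last first.
  apply: (squeeze_cvg0 _ _ _ ul) => k; rewrite (si_ge0 _ _ sbv)/= /h1form.
  by rewrite lerDr (si_ge0 _ _ sb).
have /choice[phi phiP] k : exists phi, test_function Omega phi /\
    h1 (u k - (phi, grad phi)) (u k - (phi, grad phi)) < k.+1%:R^-1.
  have [|phi tphi] := (Hu k).2 k.+1%:R^-1; first by rewrite invr_gt0.
  by rewrite H1_normsqE => ?; exists phi.
apply: (H10_of_cvg l phi Hl) => [k|]; first exact: (phiP k).1.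
apply: (squeeze_cvg0 _ _ _ (cvg0Ml 2 _ (cvg0D _ _ ul (@cvg_harmonic R)))) => k.
have Lphi := test_function_L2pair oO bO _ (phiP k).1.
have L1 : L2pair (l - u k) by apply: (subspaceB (si_sub _ _ sbh)).
have L2 : L2pair (u k - (phi k, grad (phi k))) by apply: (subspaceB (si_sub _ _ sbh)).
rewrite (si_ge0 _ _ sbh)/=.
have := quad_leD sbh _ _ L1 L2; rewrite addrA subrK => /le_trans; apply.
rewrite ler_wpM2l// lerD//; first by rewrite (quadC sbh).
exact: ltW (phiP k).2.
Qed.

Lemma h1_eq0_sob_eq u v : L2pair u -> L2pair v ->
  h1 (u - v) (u - v) = 0 -> sob_eq Omega u v.
Proof.
move=> Lu Lv h0; have [s1 s2] := subspaceB (si_sub _ _ sbh) _ _ Lu Lv.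
have g1 := si_ge0 _ _ sb (u - v).1; have g2 := si_ge0 _ _ sbv (u - v).2.
have [h1_0 h2_0] : ip (u - v).1 (u - v).1 = 0 /\ ipv (u - v).2 (u - v).2 = 0.
  by move: h0; rewrite /h1form; split; lra.
have ae1 := l2form_eq0_ae leb Omega mO _ s1 h1_0.
have ae2 i := l2form_eq0_ae leb Omega mO (fun x => (u - v).2 x ord0 i) (s2 i).
have /filter_forall ae3 : forall i, {ae leb, forall x, Omega x -> (u - v).2 x ord0 i = 0}.
  move=> i; apply: ae2; apply/eqP; rewrite eq_le (si_ge0 _ _ sb) andbT -h2_0.
  exact: l2form_comp_le.
apply: filterS2 ae1 ae3 => x x1 x2 Ox; split.
  by apply/eqP; rewrite -subr_eq0; apply/eqP; exact: x1.
apply/rowP => i; apply/eqP; rewrite -subr_eq0; apply/eqP.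
by rewrite -(x2 i Ox) -[RHS]/((u.2 x - v.2 x) ord0 i) !mxE.
Qed.

End SobolevHilbert.

(** * Superposition operators *)

Lemma dotp_semi_inner {R : realType} {n : nat} :
  semi_inner [set: 'rV[R]_n] (@dotp R n).
Proof.
split=> //.
- by move=> a b; apply: eq_bigr => i _; rewrite mulrC.
- move=> r a b d _ _ _; rewrite /dotp mulr_sumr -big_split/=.
  by apply: eq_bigr => i _; rewrite !mxE mulrDl mulrA.
- by move=> a; rewrite -enorm_sqr sqr_ge0.
Qed.

(** The Cauchy-Schwarz inequality against the vector of ones. *)
Lemma sqr_sum_le {R : realType} {n : nat} (d : 'rV[R]_n) :
  (\sum_i `|d ord0 i|) ^+ 2 <= n%:R * dotp d d.
Proof.
have := cauchy_schwarz dotp_semi_inner (const_mx 1) (\row_i `|d ord0 i|) I I.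
rewrite /dotp; under [X in X ^+ 2]eq_bigr do rewrite !mxE mul1r.
under [X in X * _]eq_bigr do rewrite mxE mul1r.
under [X in _ * X]eq_bigr do rewrite !mxE -normrM ger0_norm -?expr2 ?sqr_ge0// expr2.
by rewrite sumr_const card_ord.
Qed.

(** [measurable_fun_rV] for a field that is measurable on a subset only, as
    elements of [H1] are. *)
Lemma measurable_fun_coord d (T : measurableType d) {R : realType} {n : nat}
    (D : set T) (F : T -> 'rV[R]_n) :
  (forall i, measurable_fun D (fun x => F x ord0 i)) -> measurable_fun D F.
Proof.
move=> mF mD A mA.
suff : g_sigma_preimage (@rV_coord R n) `<=` [set B | measurable (D `&` F @^-1` B)].
  exact.
apply: smallest_sub.
  split => /=.
  - by rewrite preimage_set0 setI0.
  - move=> B mB; rewrite setTD preimage_setC.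
    rewrite (_ : D `&` _ = D `\` (D `&` F @^-1` B)); first exact: measurableD.
    by apply/seteqP; split=> x /= [Dx nB]; split=> //; [case|move=> ?; exact: nB].
  - by move=> G mG; rewrite preimage_bigcup setI_bigcupr; exact: bigcup_measurable.
rewrite -bigcup_seq => B [i _] [C mC <-] /=.
by rewrite setTI -comp_preimage; exact: mF.
Qed.

Section Superposition.
Context {R : realType} {n : nat} {Phi : 'rV[R]_n -> 'rV[R]_n} {M c : R}.
Hypothesis smoothPhi : forall i, classC 1 (fun a => Phi a ord0 i).
Hypothesis jacPhi : forall a, enorm (jacmx Phi a) <= M.
Hypothesis monoPhi : forall a1 a0,
  c * enorm (a1 - a0) ^+ 2 <= dotp (Phi a1 - Phi a0) (a1 - a0).

Let L : R := n%:R * (M ^+ 2 * n%:R).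

(** Each entry of the Jacobian is at most its Frobenius norm, so
    [lipschitz_sum] applies to each component of [Phi]; summing the squares and
    using [sqr_sum_le] costs the two factors [n]. *)
Lemma jacmx_lipschitz a b :
  dotp (Phi a - Phi b) (Phi a - Phi b) <= L * dotp (a - b) (a - b).
Proof.
have pM i j x : `|partial j (fun b => Phi b ord0 i) x| <= M.
  apply: le_trans (jacPhi x); rewrite -sqrtr_sqr; apply: ler_wsqrtr.
  rewrite (bigD1 i)//= (bigD1 j)//= mxE -addrA lerDl addr_ge0//.
    by apply: sumr_ge0 => k _; exact: sqr_ge0.
  by apply: sumr_ge0 => k _; apply: sumr_ge0 => k' _; exact: sqr_ge0.
have lip i : ((Phi a - Phi b) ord0 i) ^+ 2 <= M ^+ 2 * (n%:R * dotp (a - b) (a - b)).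
  have := lipschitz_sum (fun x => Phi x ord0 i) M
    (fun j => ((smoothPhi i).2 j).1) (fun j => pM i j) a b.
  move=> le; apply: (@le_trans _ _ ((M * \sum_j `|(a - b) ord0 j|) ^+ 2)).
    rewrite -real_normK ?num_real// ler_sqr ?nnegrE//.
      by under [X in _ <= _ * X]eq_bigr do rewrite !mxE; rewrite !mxE.
    under eq_bigr do rewrite !mxE; exact: le_trans le.
  by rewrite exprMn ler_wpM2l ?sqr_ge0//; exact: sqr_sum_le.
have -> : L * dotp (a - b) (a - b) = \sum_(i < n) M ^+ 2 * (n%:R * dotp (a - b) (a - b)).
  by rewrite sumr_const card_ord -[RHS]mulr_natl /L !mulrA.
by apply: ler_sum => i _; rewrite -expr2.
Qed.

Section OnDomain.
Context {d} {T : measurableType d}.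
Variables (mu : {measure set T -> \bar R}) (D : set T).
Hypotheses (mD : measurable D) (muD : (mu D < +oo)%E).
Implicit Types F G : T -> 'rV[R]_n.
Let sbv := l2vec_semi_inner mu D mD (n := n).

(** [Phi] grows at most linearly, and constants are square-integrable because
    the domain has finite measure. *)
Lemma superposition_L2 F : sqintv mu D F -> sqintv mu D (fun x => Phi (F x)).
Proof.
move=> sF i; have mPF : measurable_fun D (fun x => Phi (F x) ord0 i).
  apply: (measurableT_comp (continuous_measurable_rV _ (smoothPhi i).1)).
  by apply: measurable_fun_coord => j; exact: (sF j).1.
split => //.
have s0 : sqint mu D (cst (Phi 0 ord0 i)).
  by apply: (bounded_sqint mu D mD _ `|Phi 0 ord0 i|) => //; exact: measurable_cst.
have iF := integrableZl mD (2 * L) (dotp_integrable mu D mD _ _ sF sF).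
have idom := integrableD mD iF (integrableZl mD 2 s0.2).
apply: (le_integrable mD _ _ idom).
  by apply/measurable_EFinP; exact: measurable_funX.
move=> x Dx; have -> : forall a b : R,
  ((2 * L)%:E * a%:E + 2%:E * b%:E = (2 * L * a + 2 * b)%:E)%E by [].
rewrite lee_fin; apply: le_trans (ler_norm _); rewrite ger0_norm ?sqr_ge0//=.
have : ((Phi (F x) - Phi 0) ord0 i) ^+ 2 <= L * dotp (F x) (F x).
  have := jacmx_lipschitz (F x) 0; rewrite subr0; apply: le_trans.
  rewrite expr2 /dotp (bigD1 i)//= lerDl.
  by apply: sumr_ge0 => j _; rewrite -expr2 sqr_ge0.
rewrite !mxE; set p := Phi _ _ _; set q := Phi _ _ _.
(* [p^2 <= 2 (p - q)^2 + 2 q^2] *)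
by have := sqr_ge0 (p - 2 * q); nra.
Qed.

Lemma superposition_lipschitz F G : sqintv mu D F -> sqintv mu D G ->
  l2vec mu D ((fun x => Phi (F x)) - (fun x => Phi (G x)))
             ((fun x => Phi (F x)) - (fun x => Phi (G x))) <=
  L * l2vec mu D (F - G) (F - G).
Proof.
move=> sF sG; have sd := subspaceB (si_sub _ _ sbv) _ _ sF sG.
have sPd := subspaceB (si_sub _ _ sbv) _ _
  (superposition_L2 _ sF) (superposition_L2 _ sG).
have id := dotp_integrable mu D mD _ _ sd sd.
rewrite /l2vec -RintegralZl//; apply: le_Rintegral => //.
- exact: dotp_integrable.
- exact: (integrableZl mD L id).
- by move=> x _; exact: jacmx_lipschitz.
Qed.

Lemma superposition_monotone F G : sqintv mu D F -> sqintv mu D G ->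
  c * l2vec mu D (F - G) (F - G) <=
  l2vec mu D ((fun x => Phi (F x)) - (fun x => Phi (G x))) (F - G).
Proof.
move=> sF sG; have sd := subspaceB (si_sub _ _ sbv) _ _ sF sG.
have sPd := subspaceB (si_sub _ _ sbv) _ _
  (superposition_L2 _ sF) (superposition_L2 _ sG).
have id := dotp_integrable mu D mD _ _ sd sd.
rewrite /l2vec -RintegralZl//; apply: le_Rintegral => //.
- exact: (integrableZl mD c id).
- exact: dotp_integrable.
- by move=> x _; rewrite -enorm_sqr; exact: monoPhi.
Qed.

End OnDomain.
End Superposition.

(** * The Dirichlet problem *)

Theorem theorem4p2 (R : realType) (N : nat) (Omega : set 'rV[R]_N)
    (Phi : 'rV[R]_N -> 'rV[R]_N) (M c : R) :
  (0 < N)%N ->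
  open Omega -> connected Omega -> Omega !=set0 -> bounded_set Omega ->
  C1_boundary Omega ->
  0 < M -> 0 < c ->
  (forall i, classC 2 (fun a => Phi a ord0 i)) ->
  (forall a, enorm (jacmx Phi a) <= M) ->
  (forall a1 a0,
     c * enorm (a1 - a0) ^+ 2 <= dotp (Phi a1 - Phi a0) (a1 - a0)) ->
  forall u0, H1 Omega u0 ->
  exists u,
    [/\ H10 Omega (u - u0),
        weak_solution Omega Phi u,
        forall u', H10 Omega (u' - u0) -> weak_solution Omega Phi u' ->
          sob_eq Omega u' u &
        exists2 C : R, 0 < C &
          forall v, H10 Omega (v - u0) ->
            (exists2 U, corrector Omega Phi v U &
               forall U', corrector Omega Phi v U' -> sob_eq Omega U' U) /\
            H1_normsq Omega (u - v) <= C * error_functional Omega Phi v].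
Proof.
move=> N0 oO _ _ bO _ M0 c0 sPhi2 jPhi mPhi u0 Hu0.
have sPhi i : classC 1 (fun a => Phi a ord0 i).
  have [cP dP] := sPhi2 i; split=> // j; split; first exact: (dP j).1.
  by split=> //; exact: (dP j).2.1.
pose leb := @rV_lebesgue R N; pose mO := open_measurable_rV Omega oO.
pose b (u v : sob R N) := l2vec leb Omega u.2 v.2.
have sbv := l2vec_semi_inner leb Omega mO (n := N).
have sbh := h1form_semi_inner leb Omega mO (n := N).
have sH := H10_subspace oO bO.
have sb : semi_inner (H10 Omega) b.
  apply: semi_innerS sH _ (grad_form_semi_inner leb Omega mO) => w Hw.
  exact: H1_L2pair Hw.1.
have cb : rate_complete (H10 Omega) b by exact: H10_grad_complete.
have s2 w : H10 Omega w -> sqintv leb Omega w.2 by move=> Hw; exact: (H1_L2pair _ Hw.1).2.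
have muO : (leb Omega < +oo)%E by exact: lebesgue_bounded_lty.
(* The residual at [u0 + h] tested against [w]; shifting by [u0] replaces the
   affine space of competitors by the space [H10]. *)
pose A h (w : sob R N) := l2vec leb Omega (fun x => Phi ((u0 + h).2 x)) w.2.
have sF h : H10 Omega h -> sqintv leb Omega (u0 + h).2.
  by move=> Hh; apply: (subspaceD (si_sub _ _ sbv)); [exact: (H1_L2pair _ Hu0).2|exact: s2].
have sA h : H10 Omega h -> sqintv leb Omega (fun x => Phi ((u0 + h).2 x)).
  by move=> Hh; apply: (superposition_L2 sPhi jPhi) => //; exact: sF.
have dF h1 h2 : (u0 + h1).2 - (u0 + h2).2 = (h1 - h2).2 :> ('rV[R]_N -> 'rV[R]_N).
  by rewrite -[LHS]/((u0 + h1 - (u0 + h2)).2) opprD addrACA subrr add0r.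
pose L : R := N%:R * (M ^+ 2 * N%:R).
have L0 : 0 < L by rewrite !mulr_gt0 ?exprn_gt0 ?ltr0n.
have Alin h : H10 Omega h -> forall a w1 w2, H10 Omega w1 -> H10 Omega w2 ->
    A h (a *: w1 + w2) = a * A h w1 + A h w2.
  move=> Hh a w1 w2 Hw1 Hw2; rewrite /A !(si_sym _ _ sbv (fun x => Phi _)).
  by apply: (si_lin _ _ sbv); [exact: s2|exact: s2|exact: sA].
have Abnd h : H10 Omega h -> exists2 K, 0 <= K &
    forall w, H10 Omega w -> A h w ^+ 2 <= K * b w w.
  move=> Hh; pose F x := Phi ((u0 + h).2 x); exists (l2vec leb Omega F F).
    exact: si_ge0 sbv _.
  by move=> w Hw; apply: (cauchy_schwarz sbv); [exact: sA|exact: s2].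
have Alip h1 h2 w : H10 Omega h1 -> H10 Omega h2 -> H10 Omega w ->
    (A h1 w - A h2 w) ^+ 2 <= L * b (h1 - h2) (h1 - h2) * b w w.
  move=> Hh1 Hh2 Hw; rewrite /A -(formBl sbv); [|exact: sA|exact: sA|exact: s2].
  apply: le_trans (cauchy_schwarz sbv _ _ _ (s2 _ Hw)) _.
    by apply: (subspaceB (si_sub _ _ sbv)); exact: sA.
  rewrite ler_wpM2r ?(si_ge0 _ _ sb)//.
  have := superposition_lipschitz sPhi jPhi leb Omega mO muO _ _ (sF _ Hh1) (sF _ Hh2).
  by rewrite dF.
have Amono h1 h2 : H10 Omega h1 -> H10 Omega h2 ->
    c * b (h1 - h2) (h1 - h2) <= A h1 (h1 - h2) - A h2 (h1 - h2).
  move=> Hh1 Hh2; have Hd := subspaceB sH _ _ Hh1 Hh2.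
  rewrite /A -(formBl sbv); [|exact: sA|exact: sA|exact: s2].
  have := superposition_monotone sPhi jPhi mPhi leb Omega mO muO _ _ (sF _ Hh1) (sF _ Hh2).
  by rewrite dF.
have [h Hh Ah] := zarantonello sb A c L cb c0 L0 Alin Abnd Alip Amono.
have [P P0 PP] := poincare oO bO N0.
have b0 w : H10 Omega w -> b 0 w = 0 by exact: form0l.
have vE v : u0 + (v - u0) = v by rewrite addrC subrK.
have correctorP v U : H10 Omega (v - u0) -> corrector Omega Phi v U <->
    H10 Omega U /\ forall w, H10 Omega w -> b U w = - A (v - u0) w.
  move=> Hv; have := sA _ Hv; rewrite /A vE => sPv.
  have E w : H10 Omega U -> H10 Omega w ->
      \int[leb]_(x in Omega) dotp (Phi (v.2 x) + U.2 x) (w.2 x) =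
      l2vec leb Omega (fun x => Phi (v.2 x)) w.2 + b U w.
    by move=> HU Hw; rewrite -(formDl sbv)//; exact: s2.
  split=> -[HU UE]; (split; first exact: HU) => w Hw; move: (UE w Hw).
    by rewrite (E w HU Hw) => /eqP; rewrite addrC addr_eq0 => /eqP.
  by rewrite (E w HU Hw) => ->; rewrite addrN.
have q0_sob_eq u v : H10 Omega (u - v) -> sqint_pair leb Omega u ->
    sqint_pair leb Omega v -> b (u - v) (u - v) <= 0 -> sob_eq Omega u v.
  move=> Hd Lu Lv q0; apply: (h1_eq0_sob_eq oO) => //; apply/eqP.
  rewrite eq_le (si_ge0 _ _ sbh) andbT (le_trans (PP _ Hd))//.
  by rewrite mulr_ge0_le0.
have Lv v : H10 Omega (v - u0) -> sqint_pair leb Omega v.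
  move=> Hv; rewrite -(subrK u0 v).
  apply: (subspaceD (si_sub _ _ sbh)); [exact: (H1_L2pair _ Hv.1)|exact: (H1_L2pair _ Hu0)].
have hE : (u0 + h) - u0 = h by rewrite addrAC subrr add0r.
have Hu : H10 Omega (u0 + h - u0) by rewrite hE.
have H0 : H10 Omega 0 := sH.1.
have bA0 u : (forall w, H10 Omega w -> A u w = 0) ->
    forall w, H10 Omega w -> b 0 w = - A u w.
  by move=> Au w Hw; rewrite b0// Au// oppr0.
have dE (u v : sob R N) : (u - u0) - (v - u0) = u - v.
  by rewrite opprB addrA subrK.
exists (u0 + h); split; first exact: Hu.
- exact: Ah.
- move=> u' Hu' weak; have Au' w : H10 Omega w -> A (u' - u0) w = 0.
    by move=> Hw; rewrite /A vE; exact: weak.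
  have Hd : H10 Omega (u' - (u0 + h)) by rewrite -dE; exact: (subspaceB sH _ _ Hu' Hu).
  apply: q0_sob_eq; [exact: Hd|exact: (Lv _ Hu')|exact: (Lv _ Hu)|].
  have := strongly_monotone_residual sb A c _ _ _ _ c0 Hu' Hh H0 H0
    (Amono _ _ Hu' Hh) (bA0 _ Au') (bA0 _ Ah).
  have -> : u' - u0 - h = u' - (u0 + h) by rewrite opprD addrA.
  rewrite subrr (b0 _ H0) pmulr_rle0; last exact: exprn_gt0.
  exact.
- exists ((P + 1) * (2 / c ^+ 2)).
    by rewrite mulr_gt0 ?divr_gt0 ?exprn_gt0// ltr_wpDl.
  move=> v Hv.
  have [U HU UE] : exists2 U, H10 Omega U & forall w, H10 Omega w -> b U w = - A (v - u0) w.
    have [K K0 AK] := Abnd _ Hv.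
    apply: (riesz sb (fun w => - A (v - u0) w) K cb K0) => [a w1 w2 Hw1 Hw2|w Hw].
      by rewrite Alin// opprD mulrN.
    by rewrite sqrrN; exact: AK.
  have cU : corrector Omega Phi v U := (correctorP v U Hv).2 (conj HU UE).
  split.
    exists U; [exact: cU|move=> U' /(correctorP _ _ Hv)[HU' U'E]].
    have Hd := subspaceB sH _ _ HU' HU.
    apply: q0_sob_eq; [exact: Hd|exact: (H1_L2pair _ HU'.1)|exact: (H1_L2pair _ HU.1)|].
    by rewrite (formBl sb _ _ _ HU' HU Hd) (U'E _ Hd) (UE _ Hd) subrr.
  have /(correctorP _ _ Hv)[HG GE] : corrector Omega Phi v (get (corrector Omega Phi v)).
    by apply: getPex; exists U; exact: cU.
  have -> : error_functional Omega Phi v =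
      2^-1 * b (get (corrector Omega Phi v)) (get (corrector Omega Phi v)).
    by rewrite /error_functional; congr (_ * _); apply: eq_Rintegral => x _; exact: enorm_sqr.
  move: HG GE; set G := get _ => HG GE.
  have := strongly_monotone_residual sb A c _ _ _ _ c0 Hh Hv H0 HG
    (Amono _ _ Hh Hv) (bA0 _ Ah) GE.
  have -> : h - (v - u0) = u0 + h - v by rewrite opprB addrA [h + u0]addrC.
  rewrite (quadB sb _ _ H0 HG) (b0 _ HG) (b0 _ H0) => le.
  have Hd : H10 Omega (u0 + h - v) by rewrite -dE; exact: (subspaceB sH _ _ Hu Hv).
  rewrite H1_normsqE; apply: le_trans (PP _ Hd) _; rewrite -/(b _ _).
  have q0 := si_ge0 _ _ sb (u0 + h - v).
  have : b (u0 + h - v) (u0 + h - v) <= b G G / c ^+ 2.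
    by rewrite ler_pdivlMr ?exprn_gt0// mulrC; lra.
  have -> : (P + 1) * (2 / c ^+ 2) * (2^-1 * b G G) = (P + 1) * (b G G / c ^+ 2).
    by field; rewrite gt_eqF.
  by move=> le'; nra.
Qed.
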